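(* Let $S$ be a $J$-frame operator in a Krein space $(\mathcal H,[\cdot,\cdot])$. Then there exists a unique bounded operator $P$ acting on $\mathcal H$ that satisfies $P^2=S$ and $$\sigma(P)\subseteq\bigl\{z\in\mathbb C:\ z=re^{it},\ r>0,\ t\in(-\tfrac{\pi}{4},\tfrac{\pi}{4})\bigr\}.$$ Moreover, this operator is self-adjoint in the Krein space $(\mathcal H,[\cdot,\cdot])$ (it is denoted by $S^{1/2}$).
   Context: Krein spaces (over $\mathbb C$). A Krein space $(\mathcal H,[\cdot,\cdot])$ is a vector space with a Hermitian sesquilinear form admitting a fundamental decomposition $\mathcal H=\mathcal H_+\,[\dotplus]\,\mathcal H_-$, i.e. a direct, $[\cdot,\cdot]$-orthogonal sum such that $(\mathcal H_+,[\cdot,\cdot])$ and $(\mathcal H_-,-[\cdot,\cdot])$ are Hilbert spaces. The associated Hilbert inner product is $\langle x_++x_-,y_++y_-\rangle=[x_+,y_+]-[x_-,y_-]$; the norms coming from different fundamental decompositions are equivalent, so the topology of $\mathcal H$ is independent of the choice. A bounded operator $T$ on $\mathcal H$ is self-adjoint in the Krein space if $[Tx,y]=[x,Ty]$ for all $x,y$. A subspace $\mathcal L$ is uniformly positive (negative) if there is $\alpha>0$ with $[x,x]\ge\alpha\|x\|^2$ (resp. $-[x,x]\ge\alpha\|x\|^2$) for all $x\in\mathcal L$; maximal means maximal with respect to inclusion among such subspaces. $J$-frames. A family $\mathcal F=\{f_i\}_{i\in I}$ in $\mathcal H$ is a Bessel family if $\sum_{i\in I}|\langle f,f_i\rangle|^2\le\beta\|f\|^2$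 for all $f$, for some $\beta<\infty$. Its synthesis operator is the bounded operator $T:\ell_2(I)\to\mathcal H$, $Tx=\sum_{i\in I}x_if_i$. Put $I_+=\{i:[f_i,f_i]\ge0\}$, $I_-=\{i:[f_i,f_i]<0\}$, and $T_\pm x=\sum_{i\in I_\pm}x_if_i$. $\mathcal F$ is a $J$-frame for $\mathcal H$ if the range $R(T_+)$ is a maximal uniformly positive subspace and $R(T_-)$ is a maximal uniformly negative subspace of $\mathcal H$. The $J$-frame operator of $\mathcal F$ is $Sf=\sum_{i\in I_+}[f,f_i]f_i-\sum_{i\in I_-}[f,f_i]f_i$. An operator $S$ is called a $J$-frame operator if it is the $J$-frame operator of some $J$-frame for $\mathcal H$; it is bounded, boundedly invertible and self-adjoint in the Krein space. $\sigma(\cdot)$ denotes the spectrum. *)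

(* Defs.v *)
From HB Require Import structures.
From mathcomp Require Import all_boot all_order all_algebra.
From mathcomp Require Import finmap complex.
From mathcomp Require Import all_classical all_reals all_analysis.
From mathcomp.analysis.showcase Require Import summability.

Set Implicit Arguments.
Unset Strict Implicit.
Unset Printing Implicit Defensive.

Import Order.TTheory GRing.Theory Num.Theory.
Import numFieldNormedType.Exports.

Local Open Scope classical_set_scope.
Local Open Scope ring_scope.
Local Open Scope complex_scope.

Section Operators.
Context (R : realType) (V : normedModType R[i]).
Implicit Types (T B : V -> V).

Definition bounded_operator T :=
  linear T /\ exists M : R[i], forall x, `|T x| <= M * `|x|.

Definition spectrum T : set R[i] :=
  [set z | ~ exists B, [/\ bounded_operator B,
      forall x, B (T x - z *: x) = x & forall x, T (B x) - z *: B x = x]].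

(* Unordered summation of a subfamily: limit along the directed set of finite
   subsets of the index type. *)
Definition has_sum (I : choiceType) (A : set I) (g : I -> V) (v : V) :=
  (fun F : {fset I} => \sum_(i <- F | i \in A) g i) @ totally --> v.

End Operators.

Section Subspaces.
Context (R : realType) (H : lmodType R[i]).
Implicit Types (L : set H) (g : H -> H -> R[i]).

Definition is_subspace L :=
  L 0 /\ forall (a : R[i]) x y, L x -> L y -> L (a *: x + y).

(* [g] is only required to be positive definite on [L]; [g (u - v) (u - v)] is
   then the square of the distance on [L]. *)
Definition hilbert_subspace L g :=
  [/\ is_subspace L,
      forall x, L x -> x != 0 -> 0 < g x x
    & forall u : nat -> H, (forall n, L (u n)) ->
        (forall e : R, 0 < e -> exists N, forall m n, (N <= m)%N -> (N <= n)%N ->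
           g (u m - u n) (u m - u n) < e%:C) ->
        exists2 l, L l & forall e : R, 0 < e -> exists N, forall n, (N <= n)%N ->
           g (u n - l) (u n - l) < e%:C].

End Subspaces.

Section DotTriangle.
Context (C : numClosedFieldType) (U : lmodType C) (g : {dot U for Num.conj}).

Lemma dnorm_cauchy_schwarz u v : `|g u v| ^+ 2 <= g u u * g v v.
Proof.
have [->|v0] := eqVneq v 0; first
  by rewrite linear0r normr0 expr0n mulr_ge0 ?dnorm_ge0.
have gv : 0 < g v v by rewrite dnorm_gt0.
pose a := g u v / g v v.
have o : g (u - a *: v) (a *: v) = 0.
  by rewrite linearZr_LR linearBl linearZl_LR /= divfK ?gt_eqF// subrr mulr0.
have : 0 <= g (u - a *: v) (u - a *: v) by rewrite dnorm_ge0.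
have -> : g (u - a *: v) (u - a *: v) = g u u - `|a| ^+ 2 * g v v.
  by rewrite -dnormZ -[u in RHS](subrK (a *: v)) (hnormDd o) addrK.
rewrite subr_ge0 normrM exprMn normfV (gtr0_norm gv) exprVn.
by rewrite [g v v ^+ 2]expr2 invfM mulrA divfK ?gt_eqF// ler_pdivrMr.
Qed.

Lemma dnorm_triangle u v :
  sqrtC (g (u + v) (u + v)) <= sqrtC (g u u) + sqrtC (g v v).
Proof.
rewrite -ler_sqr ?nnegrE ?addr_ge0 ?sqrtC_ge0 ?dnorm_ge0//.
rewrite sqrrD !sqrtCK dnormD addrAC lerD2r lerD2l -mulr_natr.
rewrite -[leLHS](divfK (negbT (pnatr_eq0 C 2))) -ReE ler_pM2r ?ltr0n//.
rewrite (le_trans (leif_Re_Creal _))//.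
rewrite -ler_sqr ?nnegrE ?mulr_ge0 ?sqrtC_ge0 ?dnorm_ge0//.
by rewrite exprMn !sqrtCK dnorm_cauchy_schwarz.
Qed.

End DotTriangle.

(* [form] is linear in its first argument and conjugate-linear in the second. *)
Record fundamental_decomposition (R : realType) (H : lmodType R[i])
    (form : {hermitian H for false & Num.conj}) := FundamentalDecomposition {
  pos : set H;
  neg : set H;
  pos_hilbert : hilbert_subspace pos form;
  neg_hilbert : hilbert_subspace neg (fun x y => - form x y);
  pos_neg_orthogonal : forall x y, pos x -> neg y -> form x y = 0;
  pos_neg_direct : forall x,
    exists! p : H * H, [/\ pos p.1, neg p.2 & x = p.1 + p.2]
}.

(* H normed by the Hilbert inner product [hdot] associated with D. Different D
   give equivalent norms, hence the same topology, bounded operators, uniformly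
   definite subspaces and J-frames. *)
Definition krein (R : realType) (H : lmodType R[i])
  (form : {hermitian H for false & Num.conj})
  (D : fundamental_decomposition form) : Type := H.

Section KreinSpace.
Context (R : realType) (H : lmodType R[i]).
Context (form : {hermitian H for false & Num.conj}).
Context (D : fundamental_decomposition form).

HB.instance Definition _ := GRing.Lmodule.on (krein D).

Definition pos_part (x : H) : H := (projT1 (cid (pos_neg_direct D x))).1.
Definition neg_part (x : H) : H := (projT1 (cid (pos_neg_direct D x))).2.

Definition hdot (x y : H) : R[i] :=
  form (pos_part x) (pos_part y) - form (neg_part x) (neg_part y).

Definition hnorm (x : H) : R[i] := sqrtC (hdot x x).

Lemma partsP x : [/\ pos D (pos_part x), neg D (neg_part x)
  & x = pos_part x + neg_part x].
Proof. by rewrite /pos_part /neg_part; case: cid => p [] /=. Qed.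

Lemma parts_unique x p n : pos D p -> neg D n -> x = p + n ->
  pos_part x = p /\ neg_part x = n.
Proof.
move=> Dp Dn xE; rewrite /pos_part /neg_part; case: cid => q [/= _ qU].
by rewrite (qU (p, n)).
Qed.

Lemma parts_linear (a : R[i]) x y :
  pos_part (a *: x + y) = a *: pos_part x + pos_part y /\
  neg_part (a *: x + y) = a *: neg_part x + neg_part y.
Proof.
have [px nx xE] := partsP x; have [py ny yE] := partsP y.
have [[_ pl] _ _] := pos_hilbert D; have [[_ nl] _ _] := neg_hilbert D.
apply: parts_unique; [exact: pl|exact: nl|].
by rewrite [in LHS]xE [in LHS]yE scalerDr addrACA.
Qed.

Lemma hdot_linearl z : linear_for *%R (hdot^~ z).
Proof.
move=> a x y; rewrite /hdot; have [-> ->] := parts_linear a x y.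
rewrite !linearPl /= mulrBr opprD addrACA //.
Qed.

Lemma hdotC x y : hdot x y = Num.conj (hdot y x).
Proof.
rewrite /hdot [form (pos_part x) _]hermC [form (neg_part x) _]hermC.
by rewrite !expr0 !mul1r rmorphB.
Qed.

Lemma hdot_linearr z : linear_for (Num.conj \; *%R) (hdot z).
Proof.
by move=> a x y; rewrite hdotC hdot_linearl rmorphD rmorphM/= [hdot z x]hdotC
  [hdot z y]hdotC.
Qed.

Lemma hdot_gt0 x : x != 0 -> 0 < hdot x x.
Proof.
move=> x0; have [px nx xE] := partsP x.
have [_ pgt0 _] := pos_hilbert D; have [_ ngt0 _] := neg_hilbert D.
rewrite /hdot; have [p0|p0] := eqVneq (pos_part x) 0.
  have n0 : neg_part x != 0 by apply: contraNneq x0 => n0; rewrite xE p0 n0 addr0.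
  by rewrite p0 linear0l add0r; exact: ngt0.
apply: ltr_wpDr; last exact: pgt0.
have [->|n0] := eqVneq (neg_part x) 0; first by rewrite linear0l oppr0.
by apply: ltW; exact: ngt0.
Qed.

HB.instance Definition _ := bilinear_isBilinear.Build R[i] H H R[i] *%R
  (Num.conj \; *%R) hdot (hdot_linearl, hdot_linearr).

Lemma hdot_hermitian x y : hdot x y = (-1) ^+ false * Num.conj (hdot y x).
Proof. by rewrite expr0 mul1r hdotC. Qed.

HB.instance Definition _ :=
  isHermitianSesquilinear.Build R[i] H false Num.conj hdot hdot_hermitian.

HB.instance Definition _ := isDotProduct.Build R[i] H hdot hdot_gt0.

Lemma hnormD x y : hnorm (x + y) <= hnorm x + hnorm y.
Proof. exact: dnorm_triangle. Qed.

Lemma hnormZ (a : R[i]) x : hnorm (a *: x) = `|a| * hnorm x.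
Proof.
rewrite /hnorm dnormZ sqrtCM ?nnegrE ?exprn_ge0 ?dnorm_ge0//.
by rewrite sqrCK.
Qed.

Lemma hnorm0_eq0 x : hnorm x = 0 -> x = 0.
Proof. by move/eqP; rewrite sqrtC_eq0 dnorm_eq0 => /eqP. Qed.

HB.instance Definition _ :=
  Lmodule_isNormed.Build R[i] (krein D) hnormD hnormZ hnorm0_eq0.

Implicit Types (L : set (krein D)) (T : krein D -> krein D).

Definition krein_selfadjoint T := forall x y, form (T x) y = form x (T y).

Definition uniformly_positive L :=
  is_subspace L /\
  exists2 a : R, 0 < a & forall x : krein D, L x -> a%:C * `|x| ^+ 2 <= form x x.

Definition uniformly_negative L :=
  is_subspace L /\
  exists2 a : R, 0 < a & forall x : krein D, L x -> a%:C * `|x| ^+ 2 <= - form x x.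

Definition maximal_among (P : set (set (krein D))) L :=
  P L /\ forall M, P M -> L `<=` M -> M = L.

Section Frames.
Context (I : choiceType).
Implicit Types (f : I -> krein D) (c : I -> R[i]) (A : set I).

(* [Normc.normc] is the R-valued modulus; `|h| below has type R[i]. *)
Definition square_sum c : \bar R :=
  (\esum_(i in [set: I]) (Normc.normc (c i) ^+ 2)%:E)%E.

Definition ell2 : set (I -> R[i]) := [set c | (square_sum c < +oo)%E].

Definition bessel_family f := exists b : R, forall h : krein D,
  (square_sum (fun i => hdot h (f i)) <= (b * Normc.normc `|h| ^+ 2)%:E)%E.

Definition index_pos f : set I := [set i | 0 <= form (f i) (f i)].
Definition index_neg f : set I := [set i | form (f i) (f i) < 0].

(* range of the synthesis operator restricted to the indices in A *)
Definition synthesis_range f A : set (krein D) :=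
  [set v | exists2 c, ell2 c & has_sum A (fun i => c i *: f i) v].

Definition J_frame f :=
  [/\ bessel_family f,
      maximal_among uniformly_positive (synthesis_range f (index_pos f))
    & maximal_among uniformly_negative (synthesis_range f (index_neg f))].

Definition is_J_frame_operator_of f T := forall h : krein D, exists v w : krein D,
  [/\ has_sum (index_pos f) (fun i => form h (f i) *: f i) v,
      has_sum (index_neg f) (fun i => form h (f i) *: f i) w
    & T h = v - w].

End Frames.

Definition J_frame_operator T := exists (I : choiceType) (f : I -> krein D),
  J_frame f /\ is_J_frame_operator_of f T.

End KreinSpace.

Definition sector_pi4 (R : realType) : set R[i] :=
  [set z | exists r t : R, [/\ 0 < r, - (pi / 4) < t, t < pi / 4
    & z = (r * cos t) +i* (r * sin t)]].
Arguments sector_pi4 R : clear implicits.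

(* Main.v *)
Require Import Defs.
From HB Require Import structures.
From mathcomp Require Import all_boot all_order all_algebra.
From mathcomp Require Import finmap complex ring lra.
From mathcomp Require Import all_classical all_reals all_analysis.
From mathcomp.analysis.showcase Require Import summability.

Set Implicit Arguments.
Unset Strict Implicit.
Unset Printing Implicit Defensive.

Import Order.TTheory GRing.Theory Num.Theory.
Import numFieldNormedType.Exports.

Local Open Scope classical_set_scope.
Local Open Scope ring_scope.
Local Open Scope complex_scope.

(** Write S h = v h - w h, where v h is the sum of [h, f i] f i over the positive
    indices and w h the sum over the negative ones, and let
    N h g = [v h + w h, g]. Here v h lies in a maximal uniformly positive subspace
    and w h in a maximal uniformly negative one. The real part of N (S h) h is
    [v h, v h] - [w h, w h], which is at least a multiple of the sum of the
    squared norms of v h and w h, so S is strictly accretive for N as soon as N is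
    an inner product equivalent to that of the Hilbert space
    ([J_frame_operator_accretive]). The equivalence is the main geometric fact
    ([maximal_definite_coercive]): by the uniform boundedness principle the
    coefficients [h, f i] control the component of h in the range, and the
    remaining component is orthogonal to a maximal uniformly definite subspace,
    hence uniformly definite of the other sign. Adding the estimates for the two
    signs removes the indefinite term [h, h].

    A bounded strictly accretive S satisfies S = (1 - E) / t with t > 0 and E of
    norm less than 1 ([accretive_contraction]). The fixed point Y of
    Y = (E + Y^2) / 2 satisfies (1 - Y)^2 = 1 - E and has norm less than 1
    ([sqrt_contraction]), so P = (1 - Y) / sqrt t is a square root of S. Neumann
    series put the spectra of P and S in the open right half plane, and
    P^2 - z^2 = (P - z) (P + z) then puts z^2 in the right half plane for z in the
    spectrum of P. Krein self-adjointness passes from E to the iterates and to Y.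

    For uniqueness, let Q be another root. It commutes with S, hence with Y and P,
    and (Q + P) (Q - P) = 0, so it suffices that Q + P is injective. On its
    kernel, 1 + sqrt t Q coincides with the contraction Y. On the other hand
    T = (1 + sqrt t Q)^-1 has 1 - z T invertible for all z in the closed unit disc,
    and so some power of T is a contraction ([power_contraction]). Together these
    force the kernel to be 0 ([sqrt_unique]). The statement on powers is the
    spectral radius formula; it is proved by repeated squaring, with averages of
    two resolvents in place of a contour integral. *)

Local Notation absC := (@Normc.normc _).
Local Notation re := (@complex.Re _).
Local Notation im := (@complex.Im _).

(** * Complex moduli and linear maps *)

Section ComplexModulus.
Context (R : realType).
Implicit Types (z w : R[i]) (r : R).

Lemma absC_ge0 z : 0 <= absC z.
Proof. by case: z => a b /=; exact: sqrtr_ge0. Qed.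

Lemma absC_real r : absC r%:C = `|r|.
Proof. by rewrite /= expr0n /= addr0 sqrtr_sqr. Qed.

Lemma absCE z : `|z| = (absC z)%:C.
Proof. by case: z. Qed.

Lemma absC_sqr z : absC z ^+ 2 = re z ^+ 2 + im z ^+ 2.
Proof. by case: z => a b /=; rewrite sqr_sqrtr // addr_ge0 ?sqr_ge0. Qed.

Lemma absC_conj z : absC (Num.conj z) = absC z.
Proof. by case: z => a b; rewrite /Num.conj/= sqrrN. Qed.

Lemma absCB z w : absC (z - w) = absC (w - z).
Proof. by rewrite -(normcN (z - w)) opprB. Qed.

Lemma Re_le_absC z : `|re z| <= absC z.
Proof. by rewrite -lecR -absCE; exact: normc_ge_Re. Qed.

Lemma Im_le_absC z : `|im z| <= absC z.
Proof.
rewrite -ler_sqr ?nnegrE ?absC_ge0 // absC_sqr real_normK ?num_real //.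
by rewrite lerDr sqr_ge0.
Qed.

End ComplexModulus.

Section LinearMaps.
Context (R : realType) (V : lmodType R[i]) (T : V -> V) (linT : linear T).

Lemma lin_add x y : T (x + y) = T x + T y.
Proof. by have := linT 1 x y; rewrite !scale1r. Qed.

Lemma lin_zero : T 0 = 0.
Proof. by have := linT (-1) 0 0; rewrite !scaleN1r !addNr. Qed.

Lemma lin_scale a x : T (a *: x) = a *: T x.
Proof. by have := linT a x 0; rewrite lin_zero !addr0. Qed.

Lemma lin_opp x : T (- x) = - T x.
Proof. by rewrite -scaleN1r lin_scale scaleN1r. Qed.

Lemma lin_sub x y : T (x - y) = T x - T y.
Proof. by rewrite lin_add lin_opp. Qed.

End LinearMaps.

Lemma expr_lt_eps (R : realType) (q e : R) : 0 <= q -> q < 1 -> 0 < e ->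
  exists N, forall k, (N <= k)%N -> q ^+ k < e.
Proof.
move=> q0 q1 e0.
have /cvgrPdist_lt /(_ _ e0) [N _ NP] : (fun k => q ^+ k) @ \oo --> (0 : R).
  by apply: cvg_expr; rewrite ger0_norm.
exists N => k Nk; have := NP k Nk; rewrite /= sub0r normrN ger0_norm //.
exact: exprn_ge0.
Qed.

(** * Complete norms and Neumann series *)

(** The norm is a parameter, not a structure on the space: the argument passes
    between the Hilbert norm of a fundamental decomposition and an equivalent
    norm for which a given operator is accretive. *)
Record complete_norm (R : realType) (V : lmodType R[i]) (n : V -> R) : Prop :=
  CompleteNorm {
  cnormD : forall x y, n (x + y) <= n x + n y;
  cnormZ : forall a x, n (a *: x) = absC a * n x;
  cnorm0_eq0 : forall x, n x = 0 -> x = 0;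
  cnorm_complete : forall u : nat -> V,
    (forall e, 0 < e -> exists N, forall m k, (N <= m)%N -> (N <= k)%N ->
       n (u m - u k) < e) ->
    exists l, forall e, 0 < e -> exists N, forall k, (N <= k)%N ->
       n (u k - l) < e }.

Section BanachOperators.
Context (R : realType) (V : lmodType R[i]) (n : V -> R) (nP : complete_norm n).
Implicit Types (T E Y Q : V -> V) (x y : V).

Let nD := cnormD nP.
Let nZ := cnormZ nP.

Lemma cnorm0 : n 0 = 0.
Proof. by rewrite -(scale0r 0) nZ Normc.normc0 mul0r. Qed.

Lemma cnormN x : n (- x) = n x.
Proof. by rewrite -scaleN1r nZ normcN Normc.normc1 mul1r. Qed.

Lemma cnormB x y : n (x - y) = n (y - x).
Proof. by rewrite -cnormN opprB. Qed.

Lemma cnorm_ge0 x : 0 <= n x.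
Proof. by have := nD x (- x); rewrite subrr cnorm0 cnormN; lra. Qed.

Lemma cnormBD y x z : n (x - z) <= n (x - y) + n (y - z).
Proof. by rewrite -[in leLHS](subrK y x) -addrA; exact: nD. Qed.

Lemma cnorm_leD x y : n x <= n (x - y) + n y.
Proof. by rewrite -[in leLHS](subrK y x); exact: nD. Qed.

Lemma cnormZr (r : R) x : 0 <= r -> n (r%:C *: x) = r * n x.
Proof. by move=> r0; rewrite nZ absC_real ger0_norm. Qed.

Lemma cnorm_eps x : (forall e, 0 < e -> n x <= e) -> x = 0.
Proof.
move=> xe; apply: (cnorm0_eq0 nP); apply/eqP; rewrite eq_le cnorm_ge0 andbT.
by apply/ler_addgt0Pl => e e0; rewrite addr0; exact: xe.
Qed.

Lemma cnorm_geo x (C q : R) : 0 <= q -> q < 1 ->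
  (forall k, n x <= C * q ^+ k) -> x = 0.
Proof.
move=> q0 q1 xC; apply: cnorm_eps => e e0.
have C0 : 0 <= C by have := xC 0; rewrite expr0 mulr1; apply: le_trans; exact: cnorm_ge0.
have [|N /(_ N (leqnn N))] := @expr_lt_eps R q (e / (C + 1)) q0 q1.
  by apply: divr_gt0 => //; lra.
rewrite ltr_pdivlMr; last by lra.
move=> qN; apply: le_trans (xC N) _.
have : 0 <= q ^+ N by exact: exprn_ge0.
move: qN; lra.
Qed.

Lemma cnorm_geometric_cvg (u : nat -> V) (C q : R) : 0 <= q -> q < 1 ->
  (forall k, n (u k.+1 - u k) <= C * q ^+ k) ->
  exists l, forall k, n (u k - l) <= C / (1 - q) * q ^+ k.
Proof.
move=> q0 q1 uC.
have C0 : 0 <= C by have := uC 0; rewrite expr0 mulr1; apply: le_trans; exact: cnorm_ge0.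
have q1' : 0 < 1 - q by lra.
set D := C / (1 - q); have D0 : 0 <= D by rewrite divr_ge0 // ltW.
have DC : C = D * (1 - q) by rewrite /D divfK // gt_eqF.
have qk k : 0 <= q ^+ k by exact: exprn_ge0.
have step k j : n (u (k + j)%N - u k) <= D * (q ^+ k - q ^+ (k + j)).
  elim: j => [|j IH]; first by rewrite addn0 !subrr cnorm0 mulr0.
  apply: le_trans (cnormBD (u (k + j)%N) _ _) _.
  have := uC (k + j)%N; rewrite addnS DC (exprS q (k + j)).
  move: IH; lra.
have near k m : (k <= m)%N -> n (u m - u k) <= D * q ^+ k.
  move=> km; have := step k (m - k)%N; rewrite subnKC // => h; apply: le_trans h _.
  by rewrite ler_wpM2l // lerBlDr lerDl.
have small e : 0 < e -> exists N, forall k, (N <= k)%N -> D * q ^+ k < e.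
  move=> e0; have [|N NP] := @expr_lt_eps R q (e / (D + 1)) q0 q1.
    by apply: divr_gt0 => //; lra.
  exists N => k /NP; rewrite ltr_pdivlMr; last by lra.
  have := qk k; lra.
have [e e0|l lP] := cnorm_complete nP (u := u).
  have [|N NP] := small (e / 2); first by lra.
  exists N => m k Nm Nk.
  apply: le_lt_trans (cnormBD (u N) _ _) _; rewrite [n (u N - u k)]cnormB.
  have := NP N (leqnn N); have := near _ _ Nm; have := near _ _ Nk; lra.
exists l => k; apply/ler_addgt0Pr => e e0.
have [N NP] := lP e e0.
apply: le_trans (cnormBD (u (maxn N k)) _ _) _.
have := NP (maxn N k) (leq_maxl _ _); have := near k _ (leq_maxr N k).
rewrite [n (u k - _)]cnormB; lra.
Qed.

(** For a linear T the estimate gives injectivity, and surjectivity then makes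
    the inverse an everywhere defined bounded operator. *)
Definition cinvertible T :=
  (forall x, exists y, T y = x) /\ exists M : R, forall y, n y <= M * n (T y).

Definition cbounded T := exists M : R, forall x, n (T x) <= M * n x.

Lemma cbounded_ge0 T : cbounded T ->
  exists2 M : R, 0 < M & forall x, n (T x) <= M * n x.
Proof.
move=> [M MP]; exists (`|M| + 1) => [|x]; first by rewrite ltr_pwDr.
apply: le_trans (MP x) _; rewrite ler_wpM2r ?cnorm_ge0 //.
by apply: le_trans (ler_norm M) _; rewrite lerDl.
Qed.

Lemma cinvertible_gt0 T : cinvertible T ->
  exists2 M : R, 0 < M & forall y, n y <= M * n (T y).
Proof.
move=> [_ [M MP]]; exists (`|M| + 1) => [|x]; first by rewrite ltr_pwDr.
apply: le_trans (MP x) _; rewrite ler_wpM2r ?cnorm_ge0 //.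
by apply: le_trans (ler_norm M) _; rewrite lerDl.
Qed.

(** Used for P^2 - z^2 = (P - z) (P + z): a factor of an invertible product is
    invertible if the factors commute. *)
Lemma cinvertible_factor T Q : (forall x, T (Q x) = Q (T x)) -> cbounded Q ->
  cinvertible (fun x => T (Q x)) -> cinvertible T.
Proof.
move=> TQ bQ iTQ; have [M M0 MP] := cinvertible_gt0 iTQ; case: iTQ => sTQ _; split.
  by move=> x; have [y <-] := sTQ x; exists (Q y).
have [K K0 KP] := cbounded_ge0 bQ; exists (M * K) => y.
apply: le_trans (MP y) _; rewrite -mulrA TQ ler_wpM2l ?KP //; exact: ltW.
Qed.

Lemma cinvertible_scale T a : a != 0 -> cinvertible T ->
  cinvertible (fun x => a *: T x).
Proof.
move=> a0 [sT [M MP]]; split=> [x|].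
  by have [y yE] := sT (a^-1 *: x); exists y; rewrite yE scalerA mulfV // scale1r.
exists (M * absC a^-1) => y; rewrite nZ mulrA -(mulrA M) -Normc.normcM.
by rewrite mulVf // Normc.normc1 mulr1.
Qed.

Lemma contraction_solve E (q : R) x : linear E -> 0 <= q -> q < 1 ->
  (forall y, n (E y) <= q * n y) -> exists y, y - E y = x.
Proof.
move=> linE q0 q1 Eq; pose u k := iter k (fun y => x + E y) 0.
have uS k : u k.+1 = x + E (u k) by [].
have [|l lP] := @cnorm_geometric_cvg u (n x) q q0 q1.
  elim=> [|k IH]; first by rewrite uS /u /= (lin_zero linE) addr0 subr0 mulr1.
  rewrite [in u k.+2]uS [in X in _ - X]uS opprD addrACA subrr add0r -(lin_sub linE).
  apply: le_trans (Eq _) _; rewrite exprS mulrCA ler_wpM2l //; exact: IH.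
exists l; apply/eqP; rewrite -subr_eq0; apply/eqP.
set D := n x / (1 - q) in lP; apply: (@cnorm_geo _ (D + D) q q0 q1) => k.
have D0 : 0 <= D by rewrite divr_ge0 ?cnorm_ge0 //; lra.
have -> : l - E l - x = - (u k.+1 - l) + E (u k - l).
  rewrite uS (lin_sub linE) opprB.
  by rewrite opprD !addrA subrK addrAC.
apply: le_trans (nD _ _) _; rewrite cnormN mulrDl; apply: lerD.
  apply: le_trans (lP _) _; rewrite exprS ler_wpM2l // ler_piMl ?exprn_ge0 //.
  exact: ltW.
apply: le_trans (Eq _) _; apply: le_trans (lP k); rewrite ler_piMl ?cnorm_ge0 //.
exact: ltW.
Qed.

Lemma neumann E (q : R) z : linear E -> 0 <= q -> q < 1 ->
  (forall x, n (E x) <= q * n x) -> 1 <= absC z ->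
  cinvertible (fun x => z *: x - E x).
Proof.
move=> linE q0 q1 Eq z1.
have zn0 : z != 0.
  by apply: contraTneq z1 => ->; rewrite Normc.normc0 -ltNge ltr01.
have zV : absC z^-1 <= 1 by rewrite Normc.normcV invf_le1 //; apply: lt_le_trans z1.
split=> [x|].
  have [||y yE] := @contraction_solve (fun y => z^-1 *: E y) q (z^-1 *: x) _ q0 q1.
  - by move=> a u v; rewrite linE scalerDr !scalerA mulrC.
  - move=> y; rewrite nZ; apply: le_trans (Eq y).
    by rewrite ler_piMl // cnorm_ge0.
  exists y; have := congr1 ( *:%R z) yE; rewrite scalerBr !scalerA mulfV //.
  by rewrite !scale1r.
exists (1 - q)^-1 => y; rewrite mulrC ler_pdivlMr; last by lra.
have := nD (z *: y - E y) (E y); rewrite subrK nZ => h.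
have := Eq y; have : n y <= absC z * n y by rewrite ler_peMl // cnorm_ge0.
move: h; lra.
Qed.

(** * The operator square root of a small perturbation of the identity *)

(** Successive approximations to the solution of Y = (E + Y^2) / 2, an equation
    equivalent to (1 - Y)^2 = 1 - E. *)
Fixpoint sqrt_iter E k x : V :=
  if k is k'.+1 then (2^-1)%:C *: (E x + sqrt_iter E k' (sqrt_iter E k' x))
  else 0.

Lemma sqrt_iter_linear E k : linear E -> linear (sqrt_iter E k).
Proof.
move=> linE; elim: k => [|k IH] a x y /=; first by rewrite scaler0 addr0.
rewrite !IH linE scalerA mulrC -scalerA -scalerDr; congr (_ *: _).
by rewrite scalerDr !addrA; congr (_ + _); rewrite addrAC.
Qed.

Lemma half_bound x y (a b : R) : n x <= a -> n y <= b ->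
  n ((2^-1)%:C *: (x + y)) <= (a + b) / 2.
Proof.
move=> xa yb; rewrite cnormZr ?invr_ge0 //.
have := nD x y; lra.
Qed.

(** The ball of radius q is invariant because (q + q^2) / 2 <= q. *)
Lemma sqrt_iter_bound E k (q : R) x : 0 <= q -> q <= 1 ->
  (forall x, n (E x) <= q * n x) -> n (sqrt_iter E k x) <= q * n x.
Proof.
move=> q0 q1 Eq; elim: k x => [|k IH] x /=.
  by rewrite cnorm0 mulr_ge0 ?cnorm_ge0.
apply: le_trans (half_bound (Eq x) (IH _)) _.
have : q * n (sqrt_iter E k x) <= q * (q * n x) by rewrite ler_wpM2l.
have : q * (q * n x) <= 1 * (q * n x) by rewrite ler_wpM2r // mulr_ge0 ?cnorm_ge0.
lra.
Qed.

(** On the ball of radius q the map Y |-> (E + Y^2) / 2 has Lipschitz constant q,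
    since A^2 - B^2 = A (A - B) + (A - B) B even if A and B do not commute. *)
Lemma sqrt_iter_step E k (q : R) x : linear E -> 0 <= q -> q <= 1 ->
  (forall x, n (E x) <= q * n x) ->
  n (sqrt_iter E k.+1 x - sqrt_iter E k x) <= n x * q ^+ k.
Proof.
move=> linE q0 q1 Eq; elim: k x => [|k IH] x.
  rewrite subr0 expr0 mulr1 /= addr0 cnormZr ?invr_ge0 //.
  have := Eq x; have : q * n x <= 1 * n x by rewrite ler_wpM2r ?cnorm_ge0.
  have := cnorm_ge0 x; lra.
set A := sqrt_iter E k.+1; set B := sqrt_iter E k.
have linA : linear A by exact: sqrt_iter_linear.
have -> : sqrt_iter E k.+2 x - A x =
    (2^-1)%:C *: ((A (A x) - A (B x)) + (A (B x) - B (B x))).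
  rewrite addrA subrK /A /= -/A -/B -scalerBr opprD addrACA subrr add0r.
  by [].
rewrite -(lin_sub linA).
apply: le_trans (half_bound (sqrt_iter_bound _ _ q0 q1 Eq) (IH _)) _.
rewrite exprS.
have := IH x; rewrite -/A -/B => h1.
have h2 : q * n (A x - B x) <= q * (n x * q ^+ k) by rewrite ler_wpM2l.
have h3 : n (B x) * q ^+ k <= q * n x * q ^+ k.
  by rewrite ler_wpM2r ?exprn_ge0 // sqrt_iter_bound.
move: h2 h3; lra.
Qed.

(** The rate of convergence is part of the conclusion because properties of E
    are carried over to Y through the approximations. *)
Lemma sqrt_contraction E (q : R) : linear E -> 0 <= q -> q < 1 ->
  (forall x, n (E x) <= q * n x) ->
  exists Y, [/\ linear Y, forall x, n (Y x) <= q * n x,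
    forall x, (x - Y x) - Y (x - Y x) = x - E x
  & forall x k, n (sqrt_iter E k x - Y x) <= n x / (1 - q) * q ^+ k].
Proof.
move=> linE q0 q1 Eq; have q1' := ltW q1.
have /choice [Y YP] x : exists y, forall k,
    n (sqrt_iter E k x - y) <= n x / (1 - q) * q ^+ k.
  by apply: (cnorm_geometric_cvg q0 q1) => k; exact: sqrt_iter_step.
have q1n : 0 < (1 - q)^-1 by rewrite invr_gt0; lra.
have linY : linear Y.
  move=> a x y; apply/eqP; rewrite -subr_eq0; apply/eqP.
  apply: (@cnorm_geo _ ((n (a *: x + y) + absC a * n x + n y) / (1 - q)) q q0 q1) => k.
  have -> : Y (a *: x + y) - (a *: Y x + Y y) =
     - (sqrt_iter E k (a *: x + y) - Y (a *: x + y)) +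
     (a *: (sqrt_iter E k x - Y x) + (sqrt_iter E k y - Y y)).
    rewrite (sqrt_iter_linear _ linE) opprB scalerBr.
    by rewrite (addrACA (a *: sqrt_iter E k x)) -opprD subrKA.  
  apply: le_trans (nD _ _) _; rewrite cnormN.
  have := nD (a *: (sqrt_iter E k x - Y x)) (sqrt_iter E k y - Y y).
  have := YP (a *: x + y) k; have := YP y k; rewrite nZ.
  have : absC a * n (sqrt_iter E k x - Y x) <= absC a * (n x / (1 - q) * q ^+ k).
    by rewrite ler_wpM2l ?absC_ge0.
  rewrite !mulrDl !mulrA; lra.
have Yq x : n (Y x) <= q * n x.
  rewrite -subr_le0; apply/ler_addgt0Pr => e e0; rewrite add0r lerBlDr.
  have [|N /(_ N (leqnn N)) NP] := @expr_lt_eps R q (e / (n x / (1 - q) + 1)) q0 q1.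
    by apply: divr_gt0 => //; rewrite ltr_wpDl // mulr_ge0 ?cnorm_ge0 ?ltW.
  have D0 : 0 <= n x / (1 - q) by rewrite mulr_ge0 ?cnorm_ge0 ?ltW.
  move: NP; rewrite ltr_pdivlMr; last by lra.
  have := YP x N; have := sqrt_iter_bound N x q0 q1' Eq.
  have := cnorm_leD (Y x) (sqrt_iter E N x); rewrite (cnormB (Y x)).
  have : 0 <= q ^+ N by exact: exprn_ge0.
  lra.
exists Y; split=> // x.
suff YE : Y x + Y x = E x + Y (Y x).
  by rewrite (lin_sub linY) -addrA -opprD (addrA (Y x)) YE addrK.
apply/eqP; rewrite -subr_eq0; apply/eqP.
pose D := n x / (1 - q); have D0 : 0 <= D by rewrite mulr_ge0 ?cnorm_ge0 ?ltW.
apply: (@cnorm_geo _ (4 * D) q q0 q1) => k.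
pose A := sqrt_iter E k; pose B := sqrt_iter E k.+1.
have BE : B x + B x = E x + A (A x).
  rewrite {1 2}/B /= -scalerDl -rmorphD /=.
  by rewrite (_ : 2^-1 + 2^-1 = 1) ?scale1r //; lra.
have -> : Y x + Y x - (E x + Y (Y x)) =
    - ((B x - Y x) + (B x - Y x)) + ((A (A x) - Y (A x)) + Y (A x - Y x)).
  rewrite (lin_sub linY) subrKA addrACA BE -opprD opprB [in RHS]opprD (addrA (Y x + Y x)).
  by rewrite subrKA -[in RHS]addrA -opprD.
have qk : 0 <= q ^+ k by exact: exprn_ge0.
have hB : n (B x - Y x) <= D * q ^+ k.
  apply: le_trans (YP _ _) _; rewrite exprS ler_wpM2l // ler_piMl //.
have hA : n (A (A x) - Y (A x)) <= D * q ^+ k.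
  apply: le_trans (YP _ _) _; rewrite ler_wpM2r // ler_wpM2r ?(ltW q1n) //.
  apply: le_trans (sqrt_iter_bound k x q0 q1' Eq) _.
  by rewrite ler_piMl ?cnorm_ge0.
have hY : n (Y (A x - Y x)) <= D * q ^+ k.
  apply: le_trans (Yq _) _; apply: le_trans (YP x k).
  by rewrite ler_piMl ?cnorm_ge0.
apply: le_trans (nD _ _) _; rewrite cnormN.
have := nD (B x - Y x) (B x - Y x).
have := nD (A (A x) - Y (A x)) (Y (A x - Y x)).
lra.
Qed.

(** * Powers of an operator whose resolvent exists on the closed unit disc *)

Definition pencil T z x : V := x - z *: T x.

Lemma pencil_linear T z : linear T -> linear (pencil T z).
Proof.
move=> linT a x y; rewrite /pencil linT scalerBr scalerDr !scalerA opprD.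
by rewrite addrACA mulrC.
Qed.

Lemma pencilM T z x : linear T ->
  pencil T z (pencil T (- z) x) = pencil (T \o T) (z ^+ 2) x.
Proof.
move=> linT; rewrite /pencil /= scaleNr opprK (lin_add linT) (lin_scale linT).
by rewrite scalerDr scalerA -expr2 opprD addrA addrK.
Qed.

(** A bound at one point of the disc persists nearby, with the constant doubled;
    the disc is compact. *)
Lemma disc_resolvent_bound T : cbounded T ->
    (forall z, absC z <= 1 -> cinvertible (pencil T z)) ->
  exists2 M : R, 0 < M &
    forall z, absC z <= 1 -> forall x, n x <= M * n (pencil T z x).
Proof.
move=> /cbounded_ge0[K K0 KP] inv.
pose P (M : R) (p : R * R) := absC (p.1 +i* p.2) <= 1 ->
  forall x, n x <= M * n (pencil T (p.1 +i* p.2) x).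
have /compact_near_coveringP cpt : compact (`[(-1 : R), 1] `*` `[(-1 : R), 1]).
  by apply: compact_setX; exact: segment_compact.
have near_bound p : exists2 e : R, 0 < e & exists M0 : R, forall M, M0 < M ->
    forall p', ball p e p' -> P M p'.
  have close e p' : ball p e p' ->
      absC (p.1 +i* p.2 - (p'.1 +i* p'.2)) <= e + e.
    move=> [b1 b2]; rewrite (_ : _ - _ = (p.1 - p'.1)%:C + 'i%C * (p.2 - p'.2)%:C).
      apply: le_trans (le_normcD _ _) _; rewrite Normc.normcM !absC_real.
      rewrite [absC 'i%C]/= expr0n expr1n add0r sqrtr1 mul1r.
      by apply: lerD; exact: ltW.
    by apply/eqP; rewrite eq_complex /= !mul0r !mulr0 !mul1r !subr0 !addr0 !add0r !eqxx.
  case: (leP (absC (p.1 +i* p.2)) 1) => p1; last first.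
    exists ((absC (p.1 +i* p.2) - 1) / 3); first by lra.
    exists 0 => M _ p' /close h1 h2; exfalso; move: h1 h2.
    have := le_normcD (p.1 +i* p.2 - (p'.1 +i* p'.2)) (p'.1 +i* p'.2).
    rewrite subrK; lra.
  have [M M0 MP] := cinvertible_gt0 (inv _ p1).
  (* within this radius the two pencils differ at x by at most n x / (2 M) *)
  exists (4 * M * K)^-1; first by rewrite invr_gt0 !mulr_gt0.
  exists (2 * M) => M' MM' p' /close h _ x.
  apply: (@le_trans _ _ (2 * M * n (pencil T (p'.1 +i* p'.2) x))); last first.
    by rewrite ler_wpM2r ?cnorm_ge0 // ltW.
  have := MP x; set z := p.1 +i* p.2; set z' := p'.1 +i* p'.2 => hx.
  have hT : M * n (pencil T z x - pencil T z' x) <= n x / 2.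
    have -> : pencil T z x - pencil T z' x = (z' - z) *: T x.
      by rewrite /pencil opprB addrC subrKA scalerBl.
    rewrite nZ absCB -/z.
    have : absC (z - z') * n (T x) <= ((4 * M * K)^-1 + (4 * M * K)^-1) * (K * n x).
      by apply: ler_pM; rewrite ?absC_ge0 ?cnorm_ge0.
    have -> : ((4 * M * K)^-1 + (4 * M * K)^-1) * (K * n x) = M^-1 * (n x / 2).
      by field; rewrite !gt_eqF.
    by move=> hK; rewrite mulrC -ler_pdivlMr // [leRHS]mulrC.
  have : M * n (pencil T z x) <=
      M * (n (pencil T z x - pencil T z' x) + n (pencil T z' x)).
    by rewrite ler_pM2l // cnorm_leD.
  move: hT hx; rewrite mulrDr; lra.
have [|M [_ MP]] := cpt R +oo%R P _.
  move=> p _; have [e e0 [M0 MP]] := near_bound p.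
  exists (ball p e, [set M | M0 < M]) => /=.
    split; first exact: nbhsx_ballx.
    by exists M0; split=> //; exact: num_real.
  by move=> [p' M] [/= h1 h2]; exact: MP.
pose M' := `|M| + 1; exists M'; first by rewrite ltr_pwDr.
have MM' : M < M' by apply: le_lt_trans (ler_norm M) _; rewrite ltrDl.
case=> a b z1; apply: (MP _ MM' (a, b) _ z1); split => /=; rewrite in_itv /= -ler_norml.
  exact: le_trans (Re_le_absC (a +i* b)) z1.
exact: le_trans (Im_le_absC (a +i* b)) z1.
Qed.

(** For the m-th power of an operator the resolvent is an average of values of
    the original resolvent, so a Lipschitz bound along rays is inherited if the
    ray is parametrised by m-th roots. Squaring repeatedly only needs averages
    of two terms. *)
Definition ray_lipschitz (L : R) m T := forall z, absC z <= 1 ->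
  [/\ forall x, exists y, pencil T z y = x,
      forall y, pencil T z y = 0 -> y = 0
    & forall r : R, 0 <= r <= 1 -> forall x u v,
        pencil T z u = x -> pencil T ((r ^+ m)%:C * z) v = x ->
        n (u - v) <= L * (1 - r) * n x].

Lemma absC_le1_mulr (r : R) m z : 0 <= r <= 1 -> absC z <= 1 ->
  absC ((r ^+ m)%:C * z) <= 1.
Proof.
move=> /andP[r0 r1] z1; rewrite Normc.normcM absC_real ger0_norm ?exprn_ge0 //.
by apply: mulr_ile1; rewrite ?exprn_ge0 ?absC_ge0 ?exprn_ile1.
Qed.

(** The resolvent identity. *)
Lemma ray_lipschitz1 T : linear T -> cbounded T ->
    (forall z, absC z <= 1 -> cinvertible (pencil T z)) ->
  exists2 L : R, 0 < L & ray_lipschitz L 1 T.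
Proof.
move=> linT bT inv; have [M M0 MP] := disc_resolvent_bound bT inv.
have [K K0 KP] := cbounded_ge0 bT.
exists (M * K * M); first by rewrite !mulr_gt0.
move=> z z1; split=> [||r r01 x u v uE vE].
- by have [] := inv _ z1.
- move=> y y0; apply: (cnorm0_eq0 nP); apply/eqP; rewrite eq_le cnorm_ge0 andbT.
  by have := MP z z1 y; rewrite y0 cnorm0 mulr0.
have [r0 r1] := andP r01.
have linP := pencil_linear z linT.
have duv : pencil T z (u - v) = ((1 - r)%:C * z) *: T v.
  rewrite (lin_sub linP) uE -vE /pencil expr1 opprB addrC subrKA -scalerBl.
  by rewrite rmorphB /= mulrBl mul1r.
apply: le_trans (MP z z1 (u - v)) _; rewrite duv nZ Normc.normcM absC_real.
rewrite ger0_norm ?subr_ge0 //.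
have vx := MP _ (absC_le1_mulr 1 r01 z1) v; rewrite vE in vx.
have h : absC z * n (T v) <= 1 * (K * (M * n x)).
  apply: ler_pM; rewrite ?absC_ge0 ?cnorm_ge0 //.
  by apply: le_trans (KP v) _; rewrite ler_pM2l.
have -> : M * K * M * (1 - r) * n x = M * ((1 - r) * (1 * (K * (M * n x)))) by ring.
by rewrite ler_pM2l // -mulrA ler_wpM2l // subr_ge0.
Qed.

(** (1 - z^2 T^2)^-1 is the mean of (1 - z T)^-1 and (1 + z T)^-1. *)
Lemma ray_lipschitz_half (L : R) m T z x u1 u2 v : linear T ->
  ray_lipschitz L m T -> absC z <= 1 ->
  pencil T z u1 = x -> pencil T (- z) u2 = x ->
  pencil (T \o T) (z ^+ 2) v = x -> u1 + u2 = v + v.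
Proof.
move=> linT lipT z1 u1E u2E vE.
have linz := pencil_linear z linT; have linNz := pencil_linear (- z) linT.
have [_ inj _] := lipT z z1; have [|_ injN _] := lipT (- z); first by rewrite normcN.
have pC y : pencil T (- z) (pencil T z y) = pencil T z (pencil T (- z) y).
  by have := pencilM (- z) y linT; rewrite opprK sqrrN => ->; rewrite pencilM.
apply/eqP; rewrite -subr_eq0; apply/eqP; apply: injN; apply: inj.
rewrite (lin_sub linNz) (lin_sub linz) !(lin_add linNz).
rewrite (lin_add linz (pencil T (- z) u1)) (lin_add linz (pencil T (- z) v)).
rewrite (pencilM z v linT) vE -pC u1E u2E /pencil.
by rewrite scaleNr opprK addrACA subrr addr0 subrr.
Qed.

Lemma ray_lipschitz_double (L : R) m T : linear T -> ray_lipschitz L m T ->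
  ray_lipschitz L (m + m) (T \o T).
Proof.
move=> linT lipT w w1; pose z := sqrtC w.
have zw : z ^+ 2 = w by exact: sqrtCK.
have z1 : absC z <= 1.
  rewrite -(@expr_le1 _ 2) ?absC_ge0 // expr2 -Normc.normcM -expr2.
  by rewrite zw.
have z1' : absC (- z) <= 1 by rewrite normcN.
have [sol inj _] := lipT z z1; have [solN injN _] := lipT (- z) z1'.
split=> [x|y|r r01 x u v uE vE].
- have [y1 y1E] := sol x; have [y yE] := solN y1.
  by exists y; rewrite -zw -pencilM // yE.
- by rewrite -zw -pencilM // => /inj/injN.
have rz1 := absC_le1_mulr m r01 z1.
set rz := (r ^+ m)%:C * z in rz1.
have rz1' : absC (- rz) <= 1 by rewrite normcN.
have rzw : (r ^+ (m + m))%:C * w = rz ^+ 2.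
  by rewrite exprMn zw exprD rmorphM /= expr2.
have [u1 u1E] := sol x; have [u2 u2E] := solN x.
have [v1 v1E] : exists y, pencil T rz y = x by have [s _ _] := lipT _ rz1.
have [v2 v2E] : exists y, pencil T (- rz) y = x by have [s _ _] := lipT _ rz1'.
have uu : u1 + u2 = u + u.
  by apply: (ray_lipschitz_half linT lipT z1 u1E u2E); rewrite zw.
have vv : v1 + v2 = v + v.
  by apply: (ray_lipschitz_half linT lipT rz1 v1E v2E); rewrite -rzw.
have h1 : n (u1 - v1) <= L * (1 - r) * n x.
  by have [_ _ lip] := lipT z z1; exact: (lip r r01).
have h2 : n (u2 - v2) <= L * (1 - r) * n x.
  by have [_ _ lip] := lipT (- z) z1'; apply: (lip r r01) => //; rewrite mulrN.
have : n ((u - v) + (u - v)) = 2 * n (u - v).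
  by rewrite -cnormZr // -[2]/(1 + 1) rmorphD /= scalerDl !scale1r.
have -> : (u - v) + (u - v) = (u1 - v1) + (u2 - v2).
  by rewrite !(addrACA _ (- _)) -!opprD uu vv.
have := nD (u1 - v1) (u2 - v2); lra.
Qed.

Lemma iter_linear T k : linear T -> linear (iter k T).
Proof. by move=> linT; elim: k => [//|k IH] a x y /=; rewrite IH linT. Qed.

Lemma iter_bound T (a b : R) k x : 0 <= a -> 0 <= b ->
  (forall x, a * n (T x) <= b * n x) -> a ^+ k * n (iter k T x) <= b ^+ k * n x.
Proof.
move=> a0 b0 Tb; elim: k => [|k IH]; first by rewrite !expr0.
rewrite !exprS iterS -mulrA mulrCA.
have : a ^+ k * (a * n (T (iter k T x))) <= a ^+ k * (b * n (iter k T x)).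
  by rewrite ler_wpM2l // exprn_ge0.
move=> h; apply: le_trans h _; rewrite mulrCA -mulrA ler_wpM2l //.
Qed.

Lemma iter_double T k x : iter (2 ^ k.+1) T x = iter (2 ^ k) T (iter (2 ^ k) T x).
Proof. by rewrite expnS mul2n -addnn iterD. Qed.

Lemma ray_lipschitz_iter (L : R) T k : linear T -> ray_lipschitz L 1 T ->
  ray_lipschitz L (2 ^ k) (iter (2 ^ k) T).
Proof.
move=> linT lipT; elim: k => [//|k IH].
have -> : iter (2 ^ k.+1) T = iter (2 ^ k) T \o iter (2 ^ k) T.
  by apply/funext => x; rewrite iter_double.
rewrite expnS mul2n -addnn; apply: ray_lipschitz_double IH.
exact: iter_linear.
Qed.

(** If a^m c T is small, then (1 - a^m c T)^-1 is close to 1, and by the Lipschitz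
    bound so is (1 - c T)^-1; being within 1/3 of the identity, it forces c T to
    have norm at most 1/2. *)
Lemma contraction_step T (a c L : R) m : linear T -> ray_lipschitz L m T ->
  0 <= c -> c <= 1 -> 0 <= a <= 1 -> L * (1 - a) <= 1 / 4 ->
  (forall x, a ^+ m * c * n (T x) <= 1 / 16 * n x) ->
  forall x, c * n (T x) <= 1 / 2 * n x.
Proof.
move=> linT lipT c0 c1 a01 La small u.
have cabs : absC c%:C <= 1 by rewrite absC_real ger0_norm.
have [_ _ lip] := lipT _ cabs.
set x := pencil T c%:C u.
have am0 : 0 <= a ^+ m by rewrite exprn_ge0 //; case/andP: a01.
have acabs := absC_le1_mulr m a01 cabs.
have [v vE] : exists v, pencil T ((a ^+ m)%:C * c%:C) v = x.
  by have [s _ _] := lipT _ acabs.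
have uv := lip a a01 x u v erefl vE.
have cu : n (u - x) = c * n (T u).
  by rewrite /x /pencil opprB addrC subrK cnormZr.
have vx : n (v - x) <= 1 / 16 * n v.
  rewrite -vE /pencil opprB addrC subrK -rmorphM /= cnormZr ?mulr_ge0 //.
have xu : n x <= n u + c * n (T u).
  by rewrite -cu addrC -(cnormN (u - x)) opprB; exact: cnorm_leD.
have := cnormBD v u x; have := cnorm_leD v x.
have : L * (1 - a) * n x <= 1 / 4 * n x by rewrite ler_wpM2r ?cnorm_ge0.
have := cnorm_ge0 x.
move: uv vx xu; rewrite -cu; lra.
Qed.

(** One direction of the spectral radius formula. The powers of a^j T tend to 0
    when a^j is small, and [contraction_step] passes from j + 1 to j, because the
    step size 1 - a is independent of the power of T considered. *)
Lemma power_contraction T : linear T -> cbounded T ->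
    (forall z, absC z <= 1 -> cinvertible (pencil T z)) ->
  exists k, forall x, n (iter k T x) <= 1 / 2 * n x.
Proof.
move=> linT bT inv; have [L L0 lipT] := ray_lipschitz1 linT bT inv.
have [K K0 KP] := cbounded_ge0 bT.
pose a : R := 1 - (4 * (L + 1))^-1.
have L4 : 0 < (4 * (L + 1))^-1 by rewrite invr_gt0; lra.
have L4' : (4 * (L + 1))^-1 <= 1 by rewrite invf_le1; lra.
have a0 : 0 <= a by rewrite /a; lra.
have a1 : a < 1 by rewrite /a; lra.
have La : L * (1 - a) <= 1 / 4.
  rewrite /a opprB addrCA subrr addr0 ler_pdivrMr; last by lra.
  by lra.
pose claim j := exists k0, forall k, (k0 <= k)%N -> forall x,
  (a ^+ j) ^+ (2 ^ k) * n (iter (2 ^ k) T x) <= 1 / 2 * n x.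
have step j : claim j.+1 -> claim j.
  (* two more squarings turn the bound 1/2 into 1/16 *)
  move=> [k0 k0P]; exists k0.+2 => k; case: k => [//|[//|k]]; rewrite !ltnS => k0k x.
  pose c := (a ^+ j) ^+ (2 ^ k.+2).
  have c0 : 0 <= c by rewrite !exprn_ge0.
  have c1 : c <= 1 by rewrite exprn_ile1 ?exprn_ge0 // exprn_ile1 // ltW.
  apply: (@contraction_step _ a c L (2 ^ k.+2)) => //.
  - exact: iter_linear.
  - exact: ray_lipschitz_iter.
  - by rewrite a0 ltW.
  move=> {}x; rewrite /c -exprMn -exprS.
  rewrite !iter_double !expnS.
  have -> : (2 * (2 * 2 ^ k) = 2 ^ k * 4)%N by rewrite mulnA mulnC.
  rewrite exprM -[iter _ T _]/(iter 4 (iter (2 ^ k) T) x).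
  apply: le_trans (@iter_bound (iter (2 ^ k) T) _ (1 / 2) 4 x _ _ _) _.
  - by rewrite !exprn_ge0.
  - by lra.
  - exact: k0P.
  by rewrite ler_wpM2r ?cnorm_ge0 //; lra.
have [m claimm] : exists m, claim m.
  have [|m /(_ m (leqnn m)) mP] := @expr_lt_eps R a (1 / 2 / K) a0 a1.
    by apply: divr_gt0 => //; lra.
  exists m, 0%N => k _ x.
  apply: le_trans (@iter_bound T _ (1 / 2) (2 ^ k) x _ _ _) _.
  - by rewrite exprn_ge0.
  - by lra.
  - move=> {}x; move: mP; rewrite ltr_pdivlMr // => mP.
    apply: le_trans (_ : a ^+ m * (K * n x) <= _).
      by rewrite ler_wpM2l ?exprn_ge0.
    by rewrite mulrA ler_wpM2r ?cnorm_ge0 // ltW.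
  rewrite ler_wpM2r ?cnorm_ge0 // -[leRHS]expr1 ler_wiXn2l ?expn_gt0 //; lra.
have [k0 k0P] : claim 0%N by elim: m claimm => [//|m IH] /step.
exists (2 ^ k0)%N => x; have := k0P k0 (leqnn _) x.
by rewrite expr0 expr1n mul1r.
Qed.

(** Let T = (1 + Q)^-1. If Q d = - (d - Y d), then T (Y d) = d, and Y d satisfies
    the same equation; hence d = T^k (Y^k d) for all k, where Y is a contraction
    and some power of T halves norms. So d = 0, and this is applied to
    d = Q x - (x - Y x). *)
Lemma sqrt_unique Y Q (q : R) : linear Y -> 0 <= q -> q <= 1 ->
    (forall x, n (Y x) <= q * n x) -> linear Q -> cbounded Q ->
    (forall x, Q (Y x) = Y (Q x)) ->
    (forall w : R[i], 0 <= re w -> cinvertible (fun x => Q x + w *: x)) ->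
    (forall x, Q (Q x) = (x - Y x) - Y (x - Y x)) ->
  forall x, Q x = x - Y x.
Proof.
move=> linY q0 q1 Yq linQ bQ QY inv Q2.
have inv1 := inv 1 ler01; have [M M0 MP] := cinvertible_gt0 inv1.
have [K K0 KP] := cbounded_ge0 bQ.
have /choice [T TE] : forall x, exists y, Q y + 1 *: y = x by case: inv1.
have inj1 y y' : Q y + 1 *: y = Q y' + 1 *: y' -> y = y'.
  move=> yy; apply/eqP; rewrite -subr_eq0; apply/eqP; apply: cnorm_eps => e e0.
  apply: le_trans (MP _) _; rewrite (lin_sub linQ) scalerBr addrACA yy -opprD.
  by rewrite subrr cnorm0 mulr0 ltW.
have TK y : T (Q y + 1 *: y) = y by apply: inj1; rewrite TE.
have linT : linear T.
  move=> a x y; apply: inj1; rewrite TE linQ scalerDr addrACA TE.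
  by rewrite scalerA mulrC -scalerA -scalerDr TE.
have bT : cbounded T by exists M => x; apply: le_trans (MP _) _; rewrite TE.
have [|k kP] := power_contraction linT bT.
  move=> z z1.
  have pE x : pencil T z x = Q (T x) + (1 - z) *: T x.
    by rewrite /pencil -{1}(TE x) scalerBl addrA.
  have zre : 0 <= re (1 - z).
    have := Re_le_absC z; rewrite ler_norml => /andP[_ h].
    have reE : re (1 - z) = 1 - re z by case: (z).
    by rewrite reE subr_ge0; exact: le_trans h z1.
  have [sz [N NP]] := inv _ zre; split=> [x|].
    by have [y yE] := sz x; exists (Q y + 1 *: y); rewrite pE TK.
  exists ((K + 1) * `|N|) => x; rewrite pE -{1}(TE x).
  apply: (@le_trans _ _ ((K + 1) * n (T x))).
    by apply: le_trans (nD _ _) _; rewrite scale1r mulrDl mul1r lerD2r.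
  rewrite -mulrA ler_pM2l; last by lra.
  by apply: le_trans (NP _) _; rewrite ler_wpM2r ?cnorm_ge0 ?ler_norm.
have iterTY j d : Q d + d = Y d -> iter j T (iter j Y d) = d.
  elim: j d => [//|j IH] d dK; rewrite iterS iterSr IH.
    by rewrite -dK -[X in Q d + X]scale1r TK.
  by rewrite QY -(lin_add linY) dK.
move=> x; apply/eqP; rewrite -subr_eq0; apply/eqP; set d := Q x - _.
have dK : Q d + d = Y d.
  rewrite /d (lin_sub linQ) Q2 (lin_sub linQ) QY !(lin_sub linY).
  have cancel (p s e f : V) : p - s - (e - f) + (e - p) = f - s.
    by rewrite opprB -addrA subrKA addrC subrKA.
  exact: cancel.
apply: (cnorm0_eq0 nP).
have h : n (iter k Y d) <= n d.
  have := @iter_bound Y 1 1 k d; rewrite expr1n !mul1r; apply=> // y.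
  rewrite !mul1r; apply: le_trans (Yq y) _.
  by rewrite ler_piMl ?cnorm_ge0.
have := kP (iter k Y d); rewrite iterTY //.
have := cnorm_ge0 d; lra.
Qed.

Lemma sqrt_limit_commute E Y Q (q : R) : linear Q -> cbounded Q ->
    (forall x, Q (E x) = E (Q x)) -> 0 <= q -> q < 1 ->
    (forall x k, n (sqrt_iter E k x - Y x) <= n x / (1 - q) * q ^+ k) ->
  forall x, Q (Y x) = Y (Q x).
Proof.
move=> linQ bQ QE q0 q1 YP x; have [K K0 KP] := cbounded_ge0 bQ.
have QA k y : Q (sqrt_iter E k y) = sqrt_iter E k (Q y).
  elim: k y => [|k IH] y /=; first exact: (lin_zero linQ).
  by rewrite (lin_scale linQ) (lin_add linQ) QE !IH.
apply/eqP; rewrite -subr_eq0; apply/eqP.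
apply: (@cnorm_geo _ (K * (n x / (1 - q)) + n (Q x) / (1 - q)) q q0 q1) => k.
apply: le_trans (cnormBD (Q (sqrt_iter E k x)) _ _) _; rewrite mulrDl; apply: lerD.
  rewrite cnormB -(lin_sub linQ); apply: le_trans (KP _) _.
  by rewrite -mulrA ler_pM2l; first exact: YP.
by rewrite QA; exact: YP.
Qed.

Lemma sqrt_limit_symmetric E Y (q K : R) (f : V -> V -> R[i]) :
    (forall a x y z, f (a *: x + y) z = a * f x z + f y z) ->
    (forall a x y z, f z (a *: x + y) = Num.conj a * f z x + f z y) ->
    (forall x y, absC (f x y) <= K * (n x * n y)) ->
    (forall x y, f (E x) y = f x (E y)) -> 0 <= q -> q < 1 ->
    (forall x k, n (sqrt_iter E k x - Y x) <= n x / (1 - q) * q ^+ k) ->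
  forall x y, f (Y x) y = f x (Y y).
Proof.
move=> fl fr fK fE q0 q1 YP.
have f0l z : f 0 z = 0 by have := fl (-1) 0 0 z; rewrite scaler0 addr0 mulN1r addNr.
have f0r z : f z 0 = 0.
  by have := fr (-1) 0 0 z; rewrite scaler0 addr0 rmorphN1 mulN1r addNr.
have fAl x y z : f (x + y) z = f x z + f y z.
  by have := fl 1 x y z; rewrite scale1r mul1r.
have fAr x y z : f z (x + y) = f z x + f z y.
  by have := fr 1 x y z; rewrite scale1r rmorph1 mul1r.
have fNl x z : f (- x) z = - f x z.
  by have := fl (-1) x 0 z; rewrite f0l !addr0 scaleN1r mulN1r.
have fNr x z : f z (- x) = - f z x.
  by have := fr (-1) x 0 z; rewrite f0r !addr0 scaleN1r rmorphN1 mulN1r.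
have fA k x y : f (sqrt_iter E k x) y = f x (sqrt_iter E k y).
  elim: k x y => [|k IH] x y /=; first by rewrite f0l f0r.
  have := fl (2^-1)%:C (E x + sqrt_iter E k (sqrt_iter E k x)) 0 y.
  rewrite addr0 f0l addr0 => ->.
  have := fr (2^-1)%:C (E y + sqrt_iter E k (sqrt_iter E k y)) 0 x.
  rewrite addr0 f0r addr0 => ->.
  rewrite fAl fAr fE !IH; congr (_ * _).
  by rewrite /Num.conj /= oppr0.
move=> x y; apply/eqP; rewrite -subr_eq0; apply/eqP; apply: Normc.eq0_normc.
have K0 : K * (n x * n y) <= `|K| * (n x * n y).
  by rewrite ler_wpM2r ?ler_norm // mulr_ge0 ?cnorm_ge0.
apply/eqP; rewrite eq_le absC_ge0 andbT; apply/ler_addgt0Pr => e e0; rewrite add0r.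
pose C := 2 * (`|K| * (n x * n y / (1 - q))).
have C0 : 0 <= C.
  by rewrite !mulr_ge0 ?cnorm_ge0 ?invr_ge0 //; lra.
have [|k /(_ k (leqnn k)) kP] := @expr_lt_eps R q (e / (C + 1)) q0 q1.
  by rewrite divr_gt0 // ltr_wpDl.
move: kP; rewrite ltr_pdivlMr; last by lra.
move=> kP; have qk : 0 <= q ^+ k by exact: exprn_ge0.
have bnd (u w : V) r : n u <= n x / (1 - q) * r -> n w <= n y -> 0 <= r ->
    absC (f u w) <= `|K| * (n x * n y / (1 - q)) * r.
  move=> ur wy r0; apply: le_trans (fK _ _) _.
  apply: (@le_trans _ _ (`|K| * (n u * n w))).
    by rewrite ler_wpM2r ?ler_norm // mulr_ge0 ?cnorm_ge0.
  rewrite -mulrA ler_wpM2l // (_ : _ * r = n x / (1 - q) * r * n y); last by ring.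
  by apply: ler_pM; rewrite ?cnorm_ge0.
have bnd' (u w : V) r : n u <= n x -> n w <= n y / (1 - q) * r -> 0 <= r ->
    absC (f u w) <= `|K| * (n x * n y / (1 - q)) * r.
  move=> ur wy r0; apply: le_trans (fK _ _) _.
  apply: (@le_trans _ _ (`|K| * (n u * n w))).
    by rewrite ler_wpM2r ?ler_norm // mulr_ge0 ?cnorm_ge0.
  rewrite -mulrA ler_wpM2l // (_ : _ * r = n x * (n y / (1 - q) * r)); last by ring.
  by apply: ler_pM; rewrite ?cnorm_ge0.
have h1 := bnd _ y _ (YP x k) (lexx _) qk; have h2 := bnd' x _ _ (lexx _) (YP y k) qk.
have -> : f (Y x) y - f x (Y y) =
    - f (sqrt_iter E k x - Y x) y + f x (sqrt_iter E k y - Y y).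
  by rewrite fAl fAr fNl fNr opprD opprK fA addrACA addNr add0r.
apply: le_trans (le_normcD _ _) _; rewrite normcN.
move: h1 h2 kP; rewrite /C; lra.
Qed.

End BanachOperators.

(** * Hermitian forms *)

Section HermitianForms.
Context (R : realType) (V : lmodType R[i]).
Implicit Types (g : V -> V -> R[i]) (L : set V) (x y z : V).

Definition hermitian_form g :=
  (forall a x y z, g (a *: x + y) z = a * g x z + g y z) /\
  (forall x y, g x y = Num.conj (g y x)).

Definition quad g x : R := re (g x x).

(** The function q is a squared distance from the origin, such as [quad g]. *)
Definition complete_on L (q : V -> R) := forall u : nat -> V,
  (forall k, L (u k)) ->
  (forall e, 0 < e -> exists N, forall m k, (N <= m)%N -> (N <= k)%N ->
    q (u m - u k) < e) ->
  exists2 l, L l & forall e, 0 < e -> exists N, forall k, (N <= k)%N ->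
    q (u k - l) < e.

Section Algebra.
Context g (hg : hermitian_form g).

Lemma herm_addl x y z : g (x + y) z = g x z + g y z.
Proof. by have := hg.1 1 x y z; rewrite scale1r mul1r. Qed.

Lemma herm_zerol z : g 0 z = 0.
Proof. by have := hg.1 (-1) 0 0 z; rewrite scaler0 addr0 mulN1r addNr. Qed.

Lemma herm_scalel a x z : g (a *: x) z = a * g x z.
Proof. by have := hg.1 a x 0 z; rewrite herm_zerol !addr0. Qed.

Lemma herm_oppl x z : g (- x) z = - g x z.
Proof. by rewrite -scaleN1r herm_scalel mulN1r. Qed.

Lemma herm_subl x y z : g (x - y) z = g x z - g y z.
Proof. by rewrite herm_addl herm_oppl. Qed.

Lemma herm_addr x y z : g x (y + z) = g x y + g x z.
Proof. by rewrite hg.2 herm_addl rmorphD /= -!hg.2. Qed.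

Lemma herm_scaler a x z : g x (a *: z) = Num.conj a * g x z.
Proof. by rewrite hg.2 herm_scalel rmorphM /= -hg.2. Qed.

Lemma herm_oppr x z : g x (- z) = - g x z.
Proof. by rewrite hg.2 herm_oppl rmorphN /= -hg.2. Qed.

Lemma herm_subr x y z : g x (y - z) = g x y - g x z.
Proof. by rewrite herm_addr herm_oppr. Qed.

Lemma quadE x : g x x = (quad g x)%:C.
Proof.
rewrite /quad; have := hg.2 x x; case: (g x x) => a b [/eqP].
by rewrite -addr_eq0 -mulr2n mulrn_eq0 /= => /eqP ->.
Qed.

Lemma quad0 : quad g 0 = 0.
Proof. by rewrite /quad herm_zerol. Qed.

Lemma re_conj (a : R[i]) : re (Num.conj a) = re a.
Proof. by case: a. Qed.

Lemma quadD x y : quad g (x + y) = quad g x + quad g y + 2 * re (g x y).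
Proof.
rewrite /quad herm_addl !herm_addr !raddfD /= (hg.2 y x) re_conj.
ring.
Qed.

Lemma quadZ a x : quad g (a *: x) = absC a ^+ 2 * quad g x.
Proof.
rewrite /quad herm_scalel herm_scaler quadE absC_sqr /Num.conj.
case: a => a b /=; ring.
Qed.

Lemma quadN x : quad g (- x) = quad g x.
Proof. by rewrite /quad herm_oppl herm_oppr opprK. Qed.

Lemma quadB x y : quad g (x - y) = quad g x + quad g y - 2 * re (g x y).
Proof. by rewrite quadD quadN herm_oppr raddfN /= mulrN. Qed.

Lemma quadBC x y : quad g (x - y) = quad g (y - x).
Proof. by rewrite -quadN opprB. Qed.

(** Moving from x in the direction of y by the multiple of g x y with which the
    linear term has a definite sign. *)
Lemma quad_line x y (t : R) :
  quad g (x - (t%:C * g x y) *: y) =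
  quad g x + t ^+ 2 * absC (g x y) ^+ 2 * quad g y - 2 * t * absC (g x y) ^+ 2.
Proof.
rewrite quadB quadZ herm_scaler Normc.normcM absC_real exprMn real_normK ?num_real //.
congr (_ - _); rewrite rmorphM /= absC_sqr.
case: (g x y) => a b; rewrite /Num.conj /=; ring.
Qed.

End Algebra.

(** A discriminant condition, in a form that covers a vanishing leading
    coefficient. *)
Lemma quadratic_bound (c A B : R) : 0 <= c -> 0 <= B ->
  (forall t, 0 <= A + t ^+ 2 * c * B - 2 * t * c) -> c <= A * B.
Proof.
move=> c0 B0 pos; have A0 := pos 0.
rewrite expr0n /= !mul0r mulr0 mul0r addr0 subr0 in A0.
have [->|cN0] := eqVneq c 0; first exact: mulr_ge0.
have c_gt0 : 0 < c by rewrite lt_neqAle eq_sym cN0.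
have [B_eq0|BN0] := eqVneq B 0.
  have := pos ((A + 1) / (2 * c)); rewrite B_eq0 mulr0 addr0.
  have -> : 2 * ((A + 1) / (2 * c)) * c = A + 1 by field.
  lra.
have B_gt0 : 0 < B by rewrite lt_neqAle eq_sym BN0.
have := pos B^-1.
have -> : A + B^-1 ^+ 2 * c * B - 2 / B * c = A - c / B by field.
by rewrite subr_ge0 ler_pdivrMr.
Qed.

Lemma herm_cauchy_schwarz g L x y : hermitian_form g -> is_subspace L ->
  (forall x, L x -> 0 <= quad g x) -> L x -> L y ->
  absC (g x y) ^+ 2 <= quad g x * quad g y.
Proof.
move=> hg [L0 LD] pos Lx Ly; apply: quadratic_bound => [||t].
- exact: sqr_ge0.
- exact: pos.
by rewrite -quad_line //; apply: pos; rewrite addrC -scaleNr; exact: LD.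
Qed.

Lemma absCD_sqr (z w : R[i]) : absC (z + w) ^+ 2 <= 2 * absC z ^+ 2 + 2 * absC w ^+ 2.
Proof.
apply: (@le_trans _ _ ((absC z + absC w) ^+ 2)).
  by rewrite ler_sqr ?nnegrE ?addr_ge0 ?absC_ge0 // le_normcD.
have := sqr_ge0 (absC z - absC w); rewrite !expr2; lra.
Qed.

Lemma harmonic_eps (e : R) : 0 < e ->
  exists N, forall k, (N <= k)%N -> k.+1%:R^-1 < e.
Proof.
move=> e0.
have /cvgrPdist_lt /(_ _ e0) [N _ NP] := @cvg_harmonic R.
exists N => k Nk; have := NP k Nk; rewrite /= sub0r normrN ger0_norm //.
Qed.

(** A minimising sequence is Cauchy by the parallelogram law. Positivity is used
    for differences of its elements, which lie in L; so the form may be indefinite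
    outside L, as long as the values at m - h are bounded below. *)
Lemma form_projection g L h (B : R) : hermitian_form g -> is_subspace L ->
    (forall x, L x -> 0 <= quad g x) -> complete_on L (quad g) ->
    (forall m, L m -> B <= quad g (m - h)) ->
  exists2 p, L p & forall m, L m -> g (h - p) m = 0.
Proof.
move=> hg subL pos cL lowB; have [L0 LD] := subL.
have LB x y : L x -> L y -> L (x - y).
  by move=> Lx Ly; rewrite addrC -scaleN1r; exact: LD.
have LZ a x : L x -> L (a *: x) by move=> Lx; rewrite -[_ *: _]addr0; exact: LD.
pose A := [set r | exists2 m, L m & r = quad g (m - h)].
have infA : has_inf A.
  split; first by exists (quad g (0 - h)), 0.
  by exists B => r [m Lm ->]; exact: lowB.
pose d := inf A.
have dle m : L m -> d <= quad g (m - h).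
  by move=> Lm; apply: ge_inf; [case: infA|exists m].
have /choice [u uP] (k : nat) : exists m, L m /\ quad g (m - h) < d + k.+1%:R^-1.
  have [|_ [m Lm ->] mP] := inf_adherent (_ : 0 < k.+1%:R^-1) infA.
    by rewrite invr_gt0.
  by exists m.
have Lu k : L (u k) by have [] := uP k.
have ud k : quad g (u k - h) < d + k.+1%:R^-1 by have [] := uP k.
have orth k m : L m -> absC (g (u k - h) m) ^+ 2 <= k.+1%:R^-1 * quad g m.
  move=> Lm; apply: quadratic_bound => [||t]; [exact: sqr_ge0|exact: pos|].
  have := dle _ (LB _ _ (Lu k) (LZ (t%:C * g (u k - h) m) _ Lm)).
  rewrite addrAC (quad_line hg); have := ud k.
  by move: (k.+1%:R^-1) => b; lra.
have [e e0|l Ll lP] := cL u Lu.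
  have [|N NP] := @harmonic_eps (e / 4); first by lra.
  exists N => m k Nm Nk.
  have par : quad g (u m - u k) + quad g ((u m - h) + (u k - h)) =
      2 * quad g (u m - h) + 2 * quad g (u k - h).
    rewrite (_ : u m - u k = (u m - h) - (u k - h)); last by rewrite opprB subrKA.
    by rewrite (quadB hg (u m - h)) (quadD hg (u m - h)); ring.
  have mid : 4 * d <= quad g ((u m - h) + (u k - h)).
    have := dle _ (LD (2^-1)%:C _ _ (LD 1 _ _ (Lu m) (Lu k)) L0).
    rewrite addr0 scale1r => dm.
    have -> : (u m - h) + (u k - h) = 2%:C *: ((2^-1)%:C *: (u m + u k) - h).
      rewrite scalerBr scalerA -rmorphM /= mulfV // scale1r addrACA.
      by rewrite -[2]/(1 + 1) rmorphD scalerDl scale1r opprD.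
    rewrite (quadZ hg) absC_real ger0_norm // (_ : 2 ^+ 2 = 4) ?ler_pM2l //; ring.
  have := ud m; have := ud k; have := NP m Nm; have := NP k Nk.
  by move: (m.+1%:R^-1) (k.+1%:R^-1) => b b'; lra.
exists l => // m Lm.
apply/eqP; suff : absC (g (h - l) m) ^+ 2 <= 0.
  move=> h0; apply/eqP; apply: Normc.eq0_normc; apply/eqP.
  by rewrite -sqrf_eq0 eq_le h0 sqr_ge0.
apply/ler_addgt0Pr => e e0; rewrite add0r.
have m0 := pos m Lm.
have [|N NP] := @harmonic_eps (e / (4 * (quad g m + 1))).
  by apply: divr_gt0 => //; lra.
have [|N' N'P] := lP (e / (4 * (quad g m + 1))).
  by apply: divr_gt0 => //; lra.
pose k := maxn N N'.
have := NP k (leq_maxl _ _); have := N'P k (leq_maxr _ _).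
rewrite !ltr_pdivlMr; try lra.
have ul : 0 <= quad g (u k - l) by apply: pos; exact: LB.
have k0 : 0 <= k.+1%:R^-1 :> R by rewrite invr_ge0.
move=> h1 h2.
have := absCD_sqr (- g (u k - h) m) (g (u k - l) m).
rewrite normcN -(herm_oppl hg) -(herm_addl hg) opprB subrKA.
have := orth k m Lm.
have := herm_cauchy_schwarz hg subL pos (LB _ _ (Lu k) Ll) Lm.
move: h1 h2; set a := quad g (u k - l) in ul *; set b := k.+1%:R^-1 in k0 *.
lra.
Qed.

End HermitianForms.

Section HilbertNorm.
Context (R : realType) (V : lmodType R[i]) (g : V -> V -> R[i]).
Context (hg : hermitian_form g) (pos : forall x, x != 0 -> 0 < quad g x).

Definition form_norm x : R := Num.sqrt (quad g x).

Lemma quad_ge0 x : 0 <= quad g x.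
Proof. by have [->|/pos/ltW//] := eqVneq x 0; rewrite quad0. Qed.

Lemma form_norm_sqr x : form_norm x ^+ 2 = quad g x.
Proof. by rewrite sqr_sqrtr // quad_ge0. Qed.

Lemma form_norm_ge0 x : 0 <= form_norm x.
Proof. exact: sqrtr_ge0. Qed.

Lemma setT_subspace : is_subspace [set: V].
Proof. by []. Qed.

Lemma form_cauchy_schwarz x y : absC (g x y) <= form_norm x * form_norm y.
Proof.
rewrite -ler_sqr ?nnegrE ?mulr_ge0 ?absC_ge0 ?form_norm_ge0 // exprMn !form_norm_sqr.
apply: (herm_cauchy_schwarz hg setT_subspace) => // z _; exact: quad_ge0.
Qed.

Lemma form_norm_lt (e : R) x : 0 < e -> (form_norm x < e) = (quad g x < e ^+ 2).
Proof.
by move=> e0; rewrite -form_norm_sqr ltr_sqr ?nnegrE ?form_norm_ge0 // ltW.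
Qed.

Lemma form_normD x y : form_norm (x + y) <= form_norm x + form_norm y.
Proof.
rewrite -ler_sqr ?nnegrE ?addr_ge0 ?form_norm_ge0 // form_norm_sqr quadD //.
have := form_cauchy_schwarz x y; have := Re_le_absC (g x y).
have := ler_norm (re (g x y)); rewrite -!form_norm_sqr sqrrD; lra.
Qed.

Lemma form_norm_complete : complete_on [set: V] (quad g) -> complete_norm form_norm.
Proof.
move=> cg; split=> [||x x0|u uC]; first exact: form_normD.
- move=> a x; rewrite /form_norm quadZ // sqrtrM ?sqr_ge0 // sqrtr_sqr.
  by rewrite ger0_norm // absC_ge0.
- apply/eqP; apply: contraT => /pos; rewrite -form_norm_sqr x0 expr0n /=.
  by rewrite ltxx.
have [//|e e0|l _ lP] := cg u.
  have [|N NP] := uC (Num.sqrt e); first by rewrite sqrtr_gt0.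
  exists N => m k Nm Nk; have := NP m k Nm Nk.
  by rewrite form_norm_lt ?sqrtr_gt0 // sqr_sqrtr // ltW.
exists l => e e0; have [|N NP] := lP (e ^+ 2); first by rewrite exprn_gt0.
by exists N => k Nk; rewrite form_norm_lt // NP.
Qed.

End HilbertNorm.

(** * Uniform boundedness *)

Section UniformBoundedness.
Context (R : realType) (V : lmodType R[i]) (n : V -> R) (nP : complete_norm n).

(** A gliding hump. Otherwise there are functionals of the family that are large
    at successive points x k, and the steps after x k, of total length at most
    2 r k, are so short that they change the value found at x k by at most 1. *)
Lemma uniform_boundedness (L : set V) (Phi : set (V -> R[i])) :
    is_subspace L ->
    (forall x, (forall e, 0 < e -> exists2 m, L m & n (x - m) < e) -> L x) ->
    (forall f, Phi f -> forall a x y, f (a *: x + y) = a * f x + f y) ->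
    (forall f, Phi f -> exists2 K : R, 0 < K & forall x, absC (f x) <= K * n x) ->
    (forall x, L x -> exists C : R, forall f, Phi f -> absC (f x) <= C) ->
  exists2 C : R, 0 < C & forall f, Phi f -> forall x, L x -> absC (f x) <= C * n x.
Proof.
move=> [L0 LD] clL linf bndf ptw; apply: contrapT => unbounded.
have n_ge0 := cnorm_ge0 nP.
have large (C : R) : 0 < C -> exists f x, [/\ Phi f, L x & C * n x < absC (f x)].
  move=> C0; apply: contrapT => none; apply: unbounded; exists C => // f Pf x Lx.
  by rewrite leNgt; apply/negP => lt; apply: none; exists f, x.
(* a pair holds a point and the length allowed for the next step *)
pose hump (j : nat) (s t : V * R) := [/\ L t.1, 0 < t.2, t.2 <= s.2 / 2,
  n (t.1 - s.1) <= s.2 & exists f, [/\ Phi f, j%:R + 1 <= absC (f t.1)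
    & forall x, n x <= 2 * t.2 -> absC (f x) <= 1]].
have step j s : L s.1 -> 0 < s.2 -> exists t, hump j s t.
  case: s => x r /= Lx r0.
  have [f [y [Pf Ly fy]]] : exists f y, [/\ Phi f, L y & (j%:R + 1) / r * n y < absC (f y)].
    by apply: large; rewrite divr_gt0 // ltr_wpDl.
  have fD := linf f Pf; have [K K0 fK] := bndf f Pf.
  have f0 : f 0 = 0 by have := fD (-1) 0 0; rewrite scaler0 addr0 mulN1r addNr.
  have fZ a z : f (a *: z) = a * f z by have := fD a z 0; rewrite f0 !addr0.
  have ny : 0 < n y.
    rewrite lt_neqAle n_ge0 andbT eq_sym; apply: contraTneq fy => /(cnorm0_eq0 nP) ->.
    by rewrite f0 Normc.normc0 cnorm0 // mulr0 ltxx.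
  pose w := (r / n y)%:C *: y.
  have nw : n w = r by rewrite cnormZr ?divfK ?gt_eqF // divr_ge0 ?ltW.
  have Lw : L w by rewrite -[w]addr0; exact: LD.
  have fw : j%:R + 1 <= absC (f w).
    rewrite fZ Normc.normcM absC_real ger0_norm ?divr_ge0 ?(ltW r0) ?(ltW ny) //.
    have -> : j%:R + 1 = r / n y * ((j%:R + 1) / r * n y) by field; rewrite !gt_eqF.
    by rewrite ler_pM2l ?divr_gt0 // ltW.
  (* f w is half the difference of f (x + w) and f (x - w) *)
  have [t tE ft] : exists2 t, t = x + w \/ t = x - w & j%:R + 1 <= absC (f t).
    have fxw : f (x + w) = f x + f w by have := fD 1 x w; rewrite scale1r mul1r.
    have fxw' : f (x - w) = f x - f w.
      by have := fD (-1) w x; rewrite scaleN1r mulN1r ![- _ + _]addrC.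
    case: (leP (j%:R + 1) (absC (f (x + w)))) => [|lt1]; first by exists (x + w); auto.
    exists (x - w); auto; rewrite leNgt; apply/negP => lt2.
    have := le_normcD (f (x + w)) (- f (x - w)); rewrite normcN.
    have -> : f (x + w) - f (x - w) = 2%:C * f w.
      by rewrite fxw fxw' opprB addrC subrKA -[2]/(1 + 1) rmorphD mulrDl !mul1r.
    rewrite Normc.normcM absC_real ger0_norm //; move: lt1 lt2 fw; lra.
  exists (t, Num.min (r / 2) (2 * K)^-1); split => /=.
  - case: tE => ->; last by rewrite addrC -scaleN1r; apply: LD.
    by rewrite -[x]scale1r; apply: LD.
  - by rewrite lt_min invr_gt0 !mulr_gt0 // invr_gt0.
  - by rewrite ge_min lexx.
  - by case: tE => ->; rewrite addrAC subrr add0r ?(cnormN nP) nw.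
  exists f; split=> // z zs; apply: le_trans (fK z) _.
  rewrite -ler_pdivlMl // mulr1; apply: le_trans zs _.
  have -> : K^-1 = 2 * (2 * K)^-1 by field; rewrite gt_eqF.
  by rewrite ler_pM2l // ge_min lexx orbT.
have /choice [F FP] : forall js : nat * (V * R), exists t,
    L js.2.1 -> 0 < js.2.2 -> hump js.1 js.2 t.
  move=> [j s]; have [[Ls s0]|nLs] := pselect (L s.1 /\ 0 < s.2).
    by have [t tP] := step j s Ls s0; exists t.
  by exists s => ? ?; case: nLs.
pose s := fix s k := if k is k'.+1 then F (k', s k') else (0, 1).
have sS k : L (s k).1 /\ 0 < (s k).2.
  elim: k => [|k [Lk k0]]; first by [].
  by have [] := FP (k, s k) Lk k0.
have sP k : hump k (s k) (s k.+1) by have [Lk k0] := sS k; exact: FP.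
pose x k := (s k).1; pose r k := (s k).2.
have r_gt0 k : 0 < r k by have [] := sS k.
have r_half k : r k.+1 <= r k / 2 by have [] := sP k.
have xr k j : n (x (k + j)%N - x k) <= 2 * r k - 2 * r (k + j)%N.
  elim: j => [|j IH]; first by rewrite addn0 !subrr cnorm0.
  apply: le_trans (cnormBD nP (x (k + j)%N) _ _) _; rewrite addnS.
  have [_ _ _ h _] := sP (k + j)%N; have := r_half (k + j)%N.
  move: h IH; rewrite -/(x _) -/(x _) -/(r _); lra.
have xr' k m : (k <= m)%N -> n (x m - x k) <= 2 * r k.
  move=> km; have := xr k (m - k)%N; rewrite subnKC // => h.
  apply: le_trans h _; have := r_gt0 m; lra.
have r_pow k : r k <= (1 / 2) ^+ k.
  elim: k => [|k IH]; first by rewrite expr0.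
  by rewrite exprS; have := r_half k; move: IH; lra.
have r_small e : 0 < e -> exists N, forall k, (N <= k)%N -> 2 * r k < e.
  move=> e0; have [|||N NP] := @expr_lt_eps R (1 / 2) (e / 2); try lra.
  by exists N => k /NP; have := r_pow k; lra.
have [e e0|l lP] := cnorm_complete nP (u := x).
  have [|N NP] := r_small (e / 2); first by lra.
  exists N => m k Nm Nk; apply: le_lt_trans (cnormBD nP (x N) _ _) _.
  rewrite (cnormB nP (x N)).
  have := NP N (leqnn N); have := xr' _ _ Nm; have := xr' _ _ Nk; lra.
have xl k : n (l - x k) <= 2 * r k.
  apply/ler_addgt0Pr => e e0; have [N NP] := lP e e0.
  apply: le_trans (cnormBD nP (x (maxn N k)) _ _) _; rewrite (cnormB nP l).
  have := NP (maxn N k) (leq_maxl _ _); have := xr' k _ (leq_maxr N k); lra.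
have Ll : L l.
  apply: clL => e e0; have [N NP] := r_small e e0.
  exists (x N); first by have [] := sS N.
  by apply: le_lt_trans (xl N) _; exact: NP.
have [C CP] := ptw l Ll.
pose j := (Num.trunc `|C|).+1.
have [_ _ _ _ [f [Pf fj fs]]] := sP j.
have := fs (l - x j.+1) (xl _); have := CP f Pf.
have fl : f (l - x j.+1) = f l - f (x j.+1).
  by have := linf f Pf (-1) (x j.+1) l; rewrite scaleN1r mulN1r ![- _ + _]addrC.
rewrite fl; have := le_normcD (- (f l - f (x j.+1))) (f l).
rewrite normcN opprB subrK.
have : `|C| < j%:R by rewrite /j truncnS_gt.
have := ler_norm C; move: fj; rewrite -/(x j.+1); lra.
Qed.

End UniformBoundedness.

(** * Maximal uniformly definite subspaces *)

Section KreinGeometry.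
Context (R : realType) (V : lmodType R[i]).
Implicit Types (d : V -> V -> R[i]) (J : V -> V) (M L : set V).

(** A Krein space as a Hilbert inner product d with a fundamental symmetry J, the
    indefinite form being d (J x) y. Passing from J to - J exchanges the signs, so
    only the positive case of each statement is treated. *)
Record hilbert_symmetry d J : Prop := HilbertSymmetry {
  hs_form : hermitian_form d;
  hs_pos : forall x, x != 0 -> 0 < quad d x;
  hs_complete : complete_on [set: V] (quad d);
  hs_linear : linear J;
  hs_invol : forall x, J (J x) = x;
  hs_sym : forall x y, d (J x) y = d x (J y) }.

Definition uniformly_definite d f M :=
  is_subspace M /\ exists2 a : R, 0 < a & forall x, M x -> a * quad d x <= quad f x.

Definition maximal_definite d f M := uniformly_definite d f M /\
  forall M', uniformly_definite d f M' -> M `<=` M' -> M' = M.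

Lemma hilbert_symmetryN d J : hilbert_symmetry d J ->
  hilbert_symmetry d (fun x => - J x).
Proof.
case=> hd pos cd linJ JJ sJ; split=> // [a x y|x|x y].
- by rewrite linJ opprD scalerN.
- by rewrite (lin_opp linJ) opprK.
- by rewrite herm_oppl // herm_oppr // sJ.
Qed.

Context d J (H : hilbert_symmetry d J).
Let hd := hs_form H.
Let pos := hs_pos H.
Let linJ := hs_linear H.
Let f x y := d (J x) y.
Local Notation nrm := (form_norm d).

Lemma indefinite_hermitian : hermitian_form f.
Proof.
split=> [a x y z|x y]; first by rewrite /f linJ hd.1.
by rewrite /f (hs_sym H) hd.2.
Qed.
Let hf := indefinite_hermitian.

Lemma quad_symmetry x : quad d (J x) = quad d x.
Proof. by rewrite /quad (hs_sym H) (hs_invol H). Qed.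

Lemma indefinite_bound x y : absC (f x y) <= nrm x * nrm y.
Proof.
by have := form_cauchy_schwarz hd pos (J x) y; rewrite /form_norm quad_symmetry.
Qed.

Lemma quad_indefinite_le x : quad f x <= quad d x.
Proof.
have := indefinite_bound x x; have := Re_le_absC (f x x).
rewrite -expr2 (form_norm_sqr hd pos); have := ler_norm (re (f x x)).
rewrite /quad; lra.
Qed.

Lemma quad_addle x y : quad d (x + y) <= 2 * quad d x + 2 * quad d y.
Proof.
have := quad_ge0 hd pos (x - y); rewrite (quadB hd) (quadD hd); lra.
Qed.

Lemma quad_le_sub x y : quad d x <= 2 * quad d (x - y) + 2 * quad d y.
Proof. by have := quad_addle (x - y) y; rewrite subrK. Qed.

(** The closure of a uniformly definite subspace is uniformly definite with the
    same constant, so maximality makes the subspace closed. *)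
Lemma definite_closed M : maximal_definite d f M ->
  forall x, (forall e, 0 < e -> exists2 m, M m & nrm (x - m) < e) -> M x.
Proof.
move=> [[subM [a a0 aM]] maxM]; have nP := form_norm_complete hd pos (hs_complete H).
pose M' := [set x | forall e, 0 < e -> exists2 m, M m & nrm (x - m) < e].
have MM' : M `<=` M'.
  by move=> x Mx e e0; exists x => //; rewrite subrr cnorm0.
suff M'M : M' = M by move=> x xM'; rewrite -M'M.
apply: maxM => //; split.
  split; first by apply: MM'; case: subM.
  move=> c x y xM yM e e0.
  have [|m Mm xm] := xM (e / (2 * (absC c + 1))).
    by rewrite divr_gt0 // mulr_gt0 // ltr_wpDl ?absC_ge0.
  have [|k Mk yk] := yM (e / 2); first by lra.
  exists (c *: m + k); first by apply: (subM.2).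
  rewrite opprD addrACA -scalerBr; apply: le_lt_trans (cnormD nP _ _) _.
  rewrite (cnormZ nP); move: xm; rewrite ltr_pdivlMr; last first.
    by rewrite mulr_gt0 // ltr_wpDl ?absC_ge0.
  have := cnorm_ge0 nP (x - m); have := absC_ge0 c; move: yk.
  nra.
exists a => // x xM'.
pose g x y := f x y - a%:C * d x y.
have hg : hermitian_form g.
  split=> [c u v z|u v]; rewrite /g; first by rewrite hf.1 hd.1; ring.
  rewrite hf.2 hd.2 rmorphB rmorphM /= -/(Num.conj a%:C).
  by congr (_ - _ * _); rewrite /Num.conj /= oppr0.
have qg u : quad g u = quad f u - a * quad d u.
  rewrite /quad /g; case: (f u u) (d u u) => [b b'] [c c'] /=; ring.
rewrite -subr_ge0 -qg.
have gb u v : absC (g u v) <= (1 + a) * (nrm u * nrm v).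
  apply: le_trans (le_normcD _ _) _; rewrite normcN Normc.normcM absC_real.
  rewrite gtr0_norm // mulrDl mul1r; apply: lerD; first exact: indefinite_bound.
  by rewrite ler_pM2l //; exact: form_cauchy_schwarz.
apply/ler_addgt0Pr => e e0.
pose K := (1 + a) * (2 * nrm x + 1); have nx := form_norm_ge0 d x.
have K0 : 0 < K by rewrite mulr_gt0 //; lra.
have [|m Mm xm] := xM' (Num.min 1 (e / K)).
  by rewrite lt_min ltr01 divr_gt0.
move: xm; rewrite lt_min ltr_pdivlMr // => /andP[xm1 xmK].
have eM := aM m Mm; rewrite -subr_ge0 -qg in eM.
have := quadB hg x (x - m); rewrite opprB addrC subrK => qm.
have := gb x (x - m); have := gb (x - m) (x - m).
have := Re_le_absC (g x (x - m)); have := Re_le_absC (g (x - m) (x - m)).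
have := ler_norm (- re (g x (x - m))); have := ler_norm (re (g (x - m) (x - m))).
rewrite normrN.
have nxm := form_norm_ge0 d (x - m).
have h : nrm (x - m) * nrm (x - m) <= nrm (x - m) by rewrite ler_piMl // ltW.
have {}h : (1 + a) * (nrm (x - m) * nrm (x - m)) <= (1 + a) * nrm (x - m).
  by rewrite ler_pM2l //; lra.
move: qm xmK eM h; rewrite /K {3}/quad.
lra.
Qed.

(** The positive parts of the elements of M form a complete subspace, and a vector
    of the positive part orthogonal to it could be added to M; so every vector has
    the same positive part as some element of M. The projection is taken for the
    inner product g of the positive parts. *)
Lemma maximal_definite_graph M k : maximal_definite d f M ->
  exists2 m, M m & J (k - m) = - (k - m).
Proof.
move=> MP; have closedM := definite_closed MP; case: MP => [[subM [a a0 aM]] maxM].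
have nP := form_norm_complete hd pos (hs_complete H).
pose g x y := (2^-1)%:C * (d x y + f x y).
have hg : hermitian_form g.
  split=> [c u v z|u v]; rewrite /g; first by rewrite hf.1 hd.1; ring.
  rewrite hf.2 hd.2 rmorphM rmorphD /=; congr (_ * _).
  by rewrite /Num.conj /= oppr0.
have qg u : quad g u = (quad d u + quad f u) / 2.
  by rewrite /quad /g; case: (f u u) (d u u) => [b b'] [c c'] /=; lra.
have MB x y : M x -> M y -> M (x - y).
  by move=> Mx My; rewrite addrC -scaleN1r; exact: (subM.2).
have qgM x : M x -> quad d x <= 2 * quad g x.
  by move=> Mx; rewrite qg; have := aM x Mx; have := mulr_ge0 (ltW a0) (quad_ge0 hd pos x); lra.
have qgd x : quad g x <= quad d x by rewrite qg; have := quad_indefinite_le x; lra.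
have plus x : d (x + J x) (x + J x) = 4%:C * g x x /\ f (x + J x) (x + J x) = 4%:C * g x x.
  have dJ : d (J x) (J x) = d x x by rewrite (hs_sym H) (hs_invol H).
  have dxJ : d x (J x) = d (J x) x by rewrite (hs_sym H).
  rewrite /g /f (lin_add linJ) (hs_invol H) mulrA -rmorphM /=.
  rewrite !(herm_addl hd) !(herm_addr hd) dJ dxJ.
  have -> : (4 * 2^-1 : R)%:C = 2 :> R[i].
    by rewrite (_ : 4 / 2 = 1 + 1) ?rmorphD //; field.
  split; ring.
have qg0 x : 0 <= quad g x.
  have := quad_ge0 hd pos (x + J x); rewrite {1}/quad (plus x).1 (quadE hg) -rmorphM /=.
  lra.
have cM : complete_on M (quad g).
  move=> u Mu uC; have [||l _ lP] := hs_complete H (u := u); first by [].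
    move=> e e0; have [|N NP] := uC (e / 2); first by lra.
    exists N => i j Ni Nj; have := NP i j Ni Nj.
    have := qgM _ (MB _ _ (Mu i) (Mu j)); lra.
  exists l.
    apply: closedM => e e0; have [|N NP] := lP (e ^+ 2); first by rewrite exprn_gt0.
    exists (u N) => //; rewrite (form_norm_lt hd pos) // quadBC //; exact: NP.
  move=> e e0; have [N NP] := lP e e0; exists N => i Ni.
  by apply: le_lt_trans (qgd _) _; exact: NP.
have [//|//|p Mp pP] := @form_projection _ _ g M k 0 hg subM _ cM _.
exists p => //; pose x := (k - p) + J (k - p).
have fx m : M m -> f x m = 0.
  move=> Mm; have := pP m Mm; rewrite /g => /eqP.
  rewrite mulf_eq0 fmorph_eq0 invr_eq0 pnatr_eq0 /= => /eqP dfm.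
  by rewrite /f /x (lin_add linJ) (hs_invol H) (herm_addl hd) addrC.
have qfx : quad f x = quad d x by rewrite /quad (plus (k - p)).1 (plus (k - p)).2.
suff x0 : x = 0 by apply/eqP; rewrite -addr_eq0 addrC -/x x0.
pose M' := [set y | exists2 m, M m & exists c : R[i], y = m + c *: x].
have MM' : M `<=` M' by move=> m Mm; exists m => //; exists 0; rewrite scale0r addr0.
suff M'M : M' = M.
  have Mx : M x by rewrite -M'M; exists 0; [exact: subM.1|exists 1; rewrite scale1r add0r].
  apply/eqP; apply: contraT => /pos; rewrite -qfx /quad (fx x Mx).
  by rewrite ltxx.
apply: maxM => //; split.
  split=> [|c y z [m Mm [b ->]] [m' Mm' [b' ->]]]; first by apply: MM'; exact: subM.1.
  exists (c *: m + m'); first exact: subM.2.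
  by exists (c * b + b'); rewrite scalerDr addrACA scalerA -scalerDl.
have mina : 0 < Num.min a 1 by rewrite lt_min a0 ltr01.
exists (Num.min a 1 / 2) => [|y [m Mm [c ->]]]; first by lra.
rewrite [leRHS](quadD hf) (quadZ hf) qfx (hf.2 m) (herm_scalel hf) (fx m Mm) mulr0.
rewrite re_conj /= mulr0 addr0 -(quadZ hd).
have := quad_addle m (c *: x); have := aM m Mm.
have : Num.min a 1 * quad d m <= a * quad d m.
  by rewrite ler_wpM2r ?(quad_ge0 hd pos) // ge_min lexx.
have : Num.min a 1 * quad d (c *: x) <= 1 * quad d (c *: x).
  by rewrite ler_wpM2r ?(quad_ge0 hd pos) // ge_min lexx orbT.
move=> h1 h2 h3 h4.
have := ler_wpM2l (ltW mina) h4.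
move: h1 h2 h3; lra.
Qed.

(** For k orthogonal to M choose m in M such that k - m is in the negative part;
    then [k, k] = - [m, m] - |k - m|^2, because [k, m] = 0. The decomposition
    itself is the projection for the indefinite form, which is a complete inner
    product on M. *)
Lemma maximal_definite_decomposition M : maximal_definite d f M ->
  exists2 c : R, 0 < c & forall h, exists p, [/\ M p,
    forall m, M m -> f (h - p) m = 0 & c * quad d (h - p) <= - quad f (h - p)].
Proof.
move=> MP; have graph k := maximal_definite_graph k MP.
have closedM := definite_closed MP; case: MP => [[subM [a a0 aM]] maxM].
have mina : 0 < Num.min a 1 by rewrite lt_min a0 ltr01.
have MB x y : M x -> M y -> M (x - y).
  by move=> Mx My; rewrite addrC -scaleN1r; exact: (subM.2).
exists (Num.min a 1 / 2) => [|h]; first by lra.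
have fM x : M x -> 0 <= quad f x.
  by move=> Mx; apply: le_trans (aM x Mx); rewrite mulr_ge0 ?(quad_ge0 hd pos) // ltW.
have cM : complete_on M (quad f).
  move=> u Mu uC; have [||l _ lP] := hs_complete H (u := u); first by [].
    move=> e e0; have [|N NP] := uC (a * e); first by rewrite mulr_gt0.
    exists N => i j Ni Nj; have := NP i j Ni Nj.
    by have := aM _ (MB _ _ (Mu i) (Mu j)) => h1 h2; rewrite -(ltr_pM2l a0); apply: le_lt_trans h2.
  exists l.
    apply: closedM => e e0; have [|N NP] := lP (e ^+ 2); first by rewrite exprn_gt0.
    exists (u N) => //; rewrite (form_norm_lt hd pos) // quadBC //; exact: NP.
  move=> e e0; have [N NP] := lP e e0; exists N => i Ni.
  by apply: le_lt_trans (quad_indefinite_le _) _; exact: NP.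
have [|p Mp pP] := @form_projection _ _ f M h (- (quad d h + quad d h / a)) hf subM fM cM.
  move=> m Mm; rewrite (quadB hf).
  have fmh : re (f m h) <= nrm m * nrm h.
    apply: le_trans (ler_norm _) _; apply: le_trans (Re_le_absC _) _.
    exact: indefinite_bound.
  have fhh : - quad d h <= quad f h.
    have := indefinite_bound h h; have := Re_le_absC (f h h).
    rewrite -expr2 (form_norm_sqr hd pos) /quad.
    by move=> h1 h2; have := le_trans h1 h2; rewrite ler_norml => /andP[].
  have am := aM m Mm.
  have sq : 2 * (nrm m * nrm h) <= a * quad d m + quad d h / a.
    rewrite -!(form_norm_sqr hd pos) -subr_ge0.
    have -> : a * nrm m ^+ 2 + nrm h ^+ 2 / a - 2 * (nrm m * nrm h) =
        a * (nrm m - nrm h / a) ^+ 2 by field; rewrite gt_eqF.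
    by rewrite mulr_ge0 ?sqr_ge0 // ltW.
  move: fmh fhh am sq; lra.
exists p; split=> //; set k := h - p.
have [m Mm mE] := graph k.
have fkm : f k m = 0 by exact: pP.
have qkm : quad f (k - m) = - quad d (k - m).
  by rewrite {1}/quad /f mE (herm_oppl hd) raddfN.
have := quadB hf k m; rewrite fkm /= mulr0 subr0 qkm => qE.
have := quad_le_sub k m; have := aM m Mm.
have : Num.min a 1 * quad d m <= a * quad d m.
  by rewrite ler_wpM2r ?(quad_ge0 hd pos) // ge_min lexx.
have : Num.min a 1 * quad d (k - m) <= 1 * quad d (k - m).
  by rewrite ler_wpM2r ?(quad_ge0 hd pos) // ge_min lexx orbT.
move=> h1 h2 h3 h4.
have := ler_wpM2l (ltW mina) h4.
move: h1 h2 h3 qE; lra.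
Qed.

(** By uniform boundedness, applied to the functionals induced by the unit ball of
    Q, the value Q h controls the component p of h in M; the component h - p has
    negative square of the size of its norm. *)
Lemma maximal_definite_coercive M (Q : V -> R) : maximal_definite d f M ->
    (forall h, 0 <= Q h) -> (forall a h, Q (a *: h) = absC a ^+ 2 * Q h) ->
    (forall p, M p -> exists C : R, forall h, absC (f p h) ^+ 2 <= C * Q h) ->
  exists c K : R, [/\ 0 < c, 0 < K &
    forall h, c * quad d h + quad f h <= K * Q h].
Proof.
move=> MP Q0 QZ ptw; have nP := form_norm_complete hd pos (hs_complete H).
have [c c0 dec] := maximal_definite_decomposition MP.
have closedM := definite_closed MP; case: MP => [[subM [a a0 aM]] _].
have [|||C C0 CP] := @uniform_boundedness _ _ nrm nP M
    [set phi | exists2 h, Q h <= 1 & phi = f^~ h] subM closedM.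
- by move=> _ [h _ ->] b x y; rewrite hf.1.
- move=> _ [h _ ->]; exists (nrm h + 1) => [|x].
    by rewrite ltr_wpDl // form_norm_ge0.
  apply: le_trans (indefinite_bound _ _) _; rewrite mulrC ler_wpM2r ?form_norm_ge0 //.
  by rewrite lerDl.
- move=> p Mp; have [C CP] := ptw p Mp; exists (`|C| + 1) => _ [h Qh ->].
  have C1 : 0 < `|C| + 1 by rewrite ltr_wpDl.
  rewrite -ler_sqr ?nnegrE ?absC_ge0 ?(ltW C1) //; apply: le_trans (CP h) _.
  apply: (@le_trans _ _ (`|C| + 1)); last by rewrite expr2 ler_peMl ?(ltW C1) // lerDr.
  have : C * Q h <= `|C| * Q h by rewrite ler_wpM2r ?ler_norm.
  have : `|C| * Q h <= `|C| * 1 by rewrite ler_wpM2l.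
  lra.
have unif p h : M p -> absC (f p h) ^+ 2 <= C ^+ 2 * quad d p * Q h.
  move=> Mp.
  have scaled (t : R) : 0 <= t -> t ^+ 2 * Q h <= 1 -> t * absC (f p h) <= C * nrm p.
    move=> t0 tQ; have := CP (f^~ (t%:C *: h)) _ p Mp.
    rewrite (herm_scaler hf) Normc.normcM absC_conj absC_real ger0_norm //; apply.
    by exists (t%:C *: h) => //; rewrite QZ absC_real real_normK ?num_real.
  rewrite -(form_norm_sqr hd pos p).
  have [Qh0|Qh0] := eqVneq (Q h) 0.
    suff -> : absC (f p h) = 0 by rewrite Qh0 expr0n /= mulr0.
    apply/eqP; rewrite eq_le absC_ge0 andbT; apply/ler_addgt0Pr => e e0; rewrite add0r.
    have X0 : 0 <= C * nrm p by rewrite mulr_ge0 ?form_norm_ge0 // ltW.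
    have := scaled ((C * nrm p + 1) / e); rewrite Qh0 mulr0 ler01 divr_ge0; last 2 first.
    - lra.
    - exact: ltW.
    move=> /(_ isT isT); rewrite mulrAC ler_pdivrMr // => h1.
    rewrite -(ler_pM2l (_ : 0 < C * nrm p + 1)); last by lra.
    apply: le_trans h1 _; rewrite mulrDl mul1r lerDl; exact: ltW.
  have Qh : 0 < Q h by rewrite lt_neqAle eq_sym Qh0 Q0.
  pose s := Num.sqrt (Q h); have s0 : 0 < s by rewrite sqrtr_gt0.
  have sQ : Q h = s ^+ 2 by rewrite sqr_sqrtr // ltW.
  have := scaled s^-1; rewrite invr_ge0 (ltW s0) sQ -exprMn mulVf ?gt_eqF // expr1n lexx.
  move=> /(_ isT isT); rewrite mulrC ler_pdivrMr // => h1.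
  by rewrite -!exprMn ler_sqr ?nnegrE ?absC_ge0 ?mulr_ge0 ?form_norm_ge0 ?(ltW s0) ?(ltW C0).
exists (c / 2), ((c + 1) * (C / a) ^+ 2); split.
- by rewrite divr_gt0.
- by rewrite mulr_gt0 ?exprn_gt0 ?divr_gt0 //; lra.
move=> h; have [p [Mp orth neg]] := dec h.
have fph : f p h = f p p.
  rewrite -[h in LHS](subrK p) (herm_addr hf) (hf.2 p (h - p)) (orth p Mp).
  by rewrite rmorph0 add0r.
have qh : quad f h = quad f (h - p) + quad f p.
  by have := quadD hf (h - p) p; rewrite subrK (orth p Mp) /= mulr0 addr0.
have ap := aM p Mp; have dp := quad_ge0 hd pos p.
have qp : quad d p <= (C / a) ^+ 2 * Q h.
  have [dp0|dp0] := eqVneq (quad d p) 0; first by rewrite dp0 mulr_ge0 ?sqr_ge0.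
  have dp1 : 0 < quad d p by rewrite lt_neqAle eq_sym dp0.
  have := unif p h Mp; rewrite fph (quadE hf) absC_real real_normK ?num_real // => h1.
  have h2 : (a * quad d p) ^+ 2 <= quad f p ^+ 2.
    by rewrite ler_sqr ?nnegrE //; [rewrite mulr_ge0 // ltW|apply: le_trans ap; rewrite mulr_ge0 // ltW].
  have := le_trans h2 h1.
  have -> : (a * quad d p) ^+ 2 = quad d p * (a ^+ 2 * quad d p) by ring.
  have -> : C ^+ 2 * quad d p * Q h = quad d p * (C ^+ 2 * Q h) by ring.
  rewrite ler_pM2l // => h3.
  have -> : (C / a) ^+ 2 * Q h = C ^+ 2 * Q h / a ^+ 2 by field; rewrite gt_eqF.
  by rewrite ler_pdivlMr ?exprn_gt0 // [quad d p * _]mulrC.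
have := quad_le_sub h p; have := quad_indefinite_le p.
have := ler_wpM2l (_ : 0 <= c + 1) qp.
have c1 : 0 <= c + 1 by lra.
move=> /(_ c1) h1 h2 h3.
have := ler_wpM2l (ltW c0) h3.
move: h1 h2 neg; rewrite qh !mulrA; lra.
Qed.

End KreinGeometry.

(** * The Hilbert space of a fundamental decomposition *)

Section KreinHilbert.
Context (R : realType) (H : lmodType R[i]).
Context (form : {hermitian H for false & Num.conj}).
Context (D : fundamental_decomposition form).
Implicit Types (x y z : H).

Definition krein_symmetry x : H := pos_part D x - neg_part D x.

Lemma form_hermitian : hermitian_form form.
Proof.
by split=> [a x y z|x y]; [rewrite linearPl|rewrite hermC expr0 mul1r].
Qed.

Lemma hdot_hermitian_form : hermitian_form (hdot D).
Proof. by split=> [a x y z|x y]; [exact: hdot_linearl|exact: hdotC]. Qed.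

Lemma quad_hdot_gt0 x : x != 0 -> 0 < quad (hdot D) x.
Proof.
by move=> /(hdot_gt0 D); rewrite (quadE hdot_hermitian_form) ltcR.
Qed.

Lemma partsB x y : pos_part D (x - y) = pos_part D x - pos_part D y /\
  neg_part D (x - y) = neg_part D x - neg_part D y.
Proof.
have := parts_linear D (-1) y x; rewrite !scaleN1r ![- y + _]addrC => -[-> ->].
by rewrite ![- _ + _]addrC.
Qed.

Lemma parts_symmetry x : pos_part D (krein_symmetry x) = pos_part D x /\
  neg_part D (krein_symmetry x) = - neg_part D x.
Proof.
have [px nx xE] := partsP D x; apply: parts_unique => //.
have [[n0 nl] _ _] := neg_hilbert D.
by have := nl (-1) _ _ nx n0; rewrite scaleN1r addr0.
Qed.

Lemma form_pos_neg x y : form (pos_part D x) (neg_part D y) = 0.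
Proof.
have [px _ _] := partsP D x; have [_ ny _] := partsP D y.
by apply: (pos_neg_orthogonal px ny).
Qed.

Lemma hdot_symmetryE x y : hdot D (krein_symmetry x) y = form x y.
Proof.
have [_ _ xE] := partsP D x; have [_ _ yE] := partsP D y.
have hf := form_hermitian.
rewrite [in RHS]xE [in RHS]yE (herm_addl hf) !(herm_addr hf) form_pos_neg.
rewrite (hf.2 (neg_part D x)) form_pos_neg rmorph0 addr0 add0r.
by rewrite /hdot (parts_symmetry x).1 (parts_symmetry x).2 (herm_oppl hf) opprK.
Qed.

Lemma hdot_complete : complete_on [set: H] (quad (hdot D)).
Proof.
have hf := form_hermitian.
have [subp posp cp] := pos_hilbert D; have [subn posn cn] := neg_hilbert D.
have qp x : pos D x -> 0 <= quad form x.
  move=> px; have [->|x0] := eqVneq x 0; first by rewrite (quad0 hf).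
  by have := posp x px x0; rewrite (quadE hf) ltcR => /ltW.
have qn x : neg D x -> quad form x <= 0.
  move=> nx; have [->|x0] := eqVneq x 0; first by rewrite (quad0 hf).
  by have := posn x nx x0; rewrite (quadE hf) -rmorphN ltcR oppr_gt0 => /ltW.
have qE x y : quad (hdot D) (x - y) =
   quad form (pos_part D x - pos_part D y) - quad form (neg_part D x - neg_part D y).
  have [pE nE] := partsB x y.
  by rewrite /quad /hdot pE nE raddfB.
have pB x y : 0 <= quad form (pos_part D x - pos_part D y).
  by have [<- _] := partsB x y; apply: qp; have [] := partsP D (x - y).
have nB x y : quad form (neg_part D x - neg_part D y) <= 0.
  by have [_ <-] := partsB x y; apply: qn; have [] := partsP D (x - y).
move=> u _ uC.
have [n|e e0|p Dp pP] := cp (fun k => pos_part D (u k)).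
- by have [] := partsP D (u n).
- have [N NP] := uC e e0; exists N => i j Ni Nj.
  rewrite (quadE hf) ltcR; have := NP i j Ni Nj; rewrite qE.
  have := nB (u i) (u j); lra.
have [n|e e0|m Dm mP] := cn (fun k => neg_part D (u k)).
- by have [] := partsP D (u n).
- have [N NP] := uC e e0; exists N => i j Ni Nj.
  rewrite (quadE hf) -rmorphN ltcR; have := NP i j Ni Nj; rewrite qE.
  have := pB (u i) (u j); lra.
have [pE nE] := parts_unique Dp Dm erefl.
exists (p + m) => // e e0.
have [|N NP] := pP (e / 2); first by lra.
have [|N' N'P] := mP (e / 2); first by lra.
exists (maxn N N') => k; rewrite geq_max => /andP[Nk N'k].
rewrite qE pE nE; have := NP k Nk; have := N'P k N'k.
rewrite !(quadE hf) -rmorphN !ltcR; lra.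
Qed.

Lemma krein_hilbert_symmetry : hilbert_symmetry (hdot D) krein_symmetry.
Proof.
split; [exact: hdot_hermitian_form|exact: quad_hdot_gt0|exact: hdot_complete| | |].
- move=> a x y; rewrite /krein_symmetry.
  have [-> ->] := parts_linear D a x y.
  by rewrite scalerBr opprD addrACA.
- move=> x; have [_ _ xE] := partsP D x; rewrite [LHS]/krein_symmetry.
  by rewrite (parts_symmetry x).1 (parts_symmetry x).2 opprK -xE.
move=> x y; rewrite hdot_symmetryE (hdot_hermitian_form.2 x) hdot_symmetryE.
exact: form_hermitian.2.
Qed.

Lemma krein_normE (x : krein D) : `|x| = (form_norm (hdot D) x)%:C.
Proof.
change (sqrtC (hdot D x x) = (form_norm (hdot D) x)%:C).
rewrite (quadE hdot_hermitian_form) -(form_norm_sqr hdot_hermitian_form quad_hdot_gt0).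
by rewrite rmorphXn /= sqrCK // ler0c form_norm_ge0.
Qed.

Lemma uniformly_positiveE (L : set (krein D)) :
  uniformly_positive L <-> uniformly_definite (hdot D) form L.
Proof.
have hf := form_hermitian.
have hd := hdot_hermitian_form.
by split=> -[sL [a a0 aL]]; split=> //; exists a => // x Lx; have := aL x Lx;
  rewrite krein_normE -rmorphXn -rmorphM (quadE hf) /= lecR
    (form_norm_sqr hd quad_hdot_gt0).
Qed.

Lemma uniformly_negativeE (L : set (krein D)) :
  uniformly_negative L <-> uniformly_definite (hdot D) (fun x y => - form x y) L.
Proof.
have hf := form_hermitian.
have hd := hdot_hermitian_form.
by split=> -[sL [a a0 aL]]; split=> //; exists a => // x Lx; have := aL x Lx;
  rewrite krein_normE -rmorphXn -rmorphM (quadE hf) -rmorphN /= lecR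
    (form_norm_sqr hd quad_hdot_gt0) /quad raddfN.
Qed.

Lemma maximal_positiveE (L : set (krein D)) :
  maximal_among (@uniformly_positive _ _ form D) L ->
  maximal_definite (hdot D) form L.
Proof.
move=> [/uniformly_positiveE uL maxL]; split=> // M /uniformly_positiveE uM LM.
exact: maxL.
Qed.

Lemma maximal_negativeE (L : set (krein D)) :
  maximal_among (@uniformly_negative _ _ form D) L ->
  maximal_definite (hdot D) (fun x y => - form x y) L.
Proof.
move=> [/uniformly_negativeE uL maxL]; split=> // M /uniformly_negativeE uM LM.
exact: maxL.
Qed.

Lemma form_bound x y :
  absC (form x y) <= form_norm (hdot D) x * form_norm (hdot D) y.
Proof.
by rewrite -hdot_symmetryE; exact: (indefinite_bound krein_hilbert_symmetry).
Qed.

Lemma has_sum_close (I : choiceType) (A : set I) (g : I -> krein D) (v : krein D) :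
  has_sum A g v -> forall e : R, 0 < e -> exists F0 : {fset I}, forall F : {fset I},
    (F0 `<=` F)%fset -> form_norm (hdot D) (v - \sum_(i <- F | i \in A) g i) < e.
Proof.
move=> /cvgrPdist_lt gv e e0.
have ec : 0 < e%:C :> R[i] by rewrite ltcE /= eqxx.
have [|F0 _ F0P] := gv _ _ ec; first by apply: filter_filter; exact: totally_filter.
by exists F0 => F F0F; have := F0P F F0F; rewrite krein_normE ltcR.
Qed.

End KreinHilbert.

(** * J-frames *)

Section FiniteSums.
Context (R : realType) (I : Type) (s : seq I) (P : pred I).

Lemma sum_cauchy_schwarz (a b : I -> R) :
  (\sum_(i <- s | P i) a i * b i) ^+ 2 <=
  (\sum_(i <- s | P i) a i ^+ 2) * (\sum_(i <- s | P i) b i ^+ 2).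
Proof.
apply: quadratic_bound => [||t]; first exact: sqr_ge0.
  by apply: sumr_ge0 => i _; exact: sqr_ge0.
set c := \sum_(i <- s | P i) a i * b i.
have -> : \sum_(i <- s | P i) a i ^+ 2
    + t ^+ 2 * c ^+ 2 * (\sum_(i <- s | P i) b i ^+ 2) - 2 * t * c ^+ 2 =
    \sum_(i <- s | P i) (a i - t * c * b i) ^+ 2.
  rewrite [RHS](eq_bigr (fun i =>
    a i ^+ 2 + (t * c) ^+ 2 * b i ^+ 2 - 2 * t * c * (a i * b i))); last first.
    by move=> i _; ring.
  rewrite sumrB big_split /= -!mulr_sumr -/c.
  by rewrite exprMn expr2 -[c ^+ 2]/(c * c); ring.
by apply: sumr_ge0 => i _; exact: sqr_ge0.
Qed.

Lemma absC_sum (z : I -> R[i]) :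
  absC (\sum_(i <- s | P i) z i) <= \sum_(i <- s | P i) absC (z i).
Proof.
elim/big_rec2 : _ => [|i y w _ IH]; first by rewrite Normc.normc0.
by apply: le_trans (le_normcD _ _) _; rewrite lerD2l.
Qed.

Lemma absC_sum_cauchy_schwarz (a b : I -> R[i]) :
  absC (\sum_(i <- s | P i) a i * b i) ^+ 2 <=
  (\sum_(i <- s | P i) absC (a i) ^+ 2) * (\sum_(i <- s | P i) absC (b i) ^+ 2).
Proof.
apply: le_trans (sum_cauchy_schwarz (absC \o a) (absC \o b)).
rewrite ler_sqr ?nnegrE ?absC_ge0 //; last first.
  by apply: sumr_ge0 => i _; rewrite mulr_ge0 ?absC_ge0.
apply: le_trans (absC_sum _) _; apply: ler_sum => i _.
by rewrite Normc.normcM.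
Qed.

End FiniteSums.

Lemma ler_sum_filter (R : numDomainType) (I : Type) (s : seq I) (P : pred I) (F : I -> R) :
  (forall i, 0 <= F i) -> \sum_(i <- s | P i) F i <= \sum_(i <- s) F i.
Proof.
move=> F0; rewrite [leRHS](bigID P) /= lerDl.
by apply: sumr_ge0.
Qed.

Lemma ler_sum_fset (R : numDomainType) (I : choiceType) (F G : {fset I})
    (P : pred I) (a : I -> R) : (F `<=` G)%fset -> (forall i, 0 <= a i) ->
  \sum_(i <- F | P i) a i <= \sum_(i <- G | P i) a i.
Proof.
move=> FG a0; rewrite big_mkcond [leRHS]big_mkcond [leRHS](big_fsetID _ (mem F)) /=.
have -> : [fset i in G | i \in F]%fset = F.
  by apply/fsetP => i; rewrite !inE andb_idl // => /(fsubsetP FG).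
by rewrite lerDl; apply: sumr_ge0 => i _; case: ifP.
Qed.

Lemma square_sum_ge (R : realType) (I : choiceType) (c : I -> R[i]) (F : {fset I}) :
  ((\sum_(i <- F) absC (c i) ^+ 2)%:E <= square_sum c)%E.
Proof.
apply: esum_ge; exists [set` F]; first by split=> //; exact: finite_fset.
by rewrite fsbig_finite ?set_fsetK ?sumEFin //; exact: finite_fset.
Qed.

Lemma ell2_bound (R : realType) (I : choiceType) (c : I -> R[i]) : ell2 c ->
  exists2 C : R, 0 < C & forall F : {fset I}, \sum_(i <- F) absC (c i) ^+ 2 <= C.
Proof.
rewrite /ell2 /=; have := square_sum_ge c; case: (square_sum c) => [r| |] // ge _.
exists (`|r| + 1) => [|F]; first by rewrite ltr_wpDl.
have := ge F; rewrite lee_fin => /le_trans; apply.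
by apply: le_trans (ler_norm r) _; rewrite lerDl.
by have := ge fset0; rewrite leNgt ltNyr.
Qed.

Section FrameForms.
Context (R : realType) (H : lmodType R[i]).
Context (form : {hermitian H for false & Num.conj}).
Context (D : fundamental_decomposition form).
Context (I : choiceType) (f : I -> krein D).
Local Notation nrm := (form_norm (hdot D)).
Local Notation qd := (quad (hdot D)).
Let hf := form_hermitian form.
Let hd := hdot_hermitian_form D.
Let qd0 := @quad_hdot_gt0 R H form D.

Definition form_bessel (B : R) := forall (h : H) (F : {fset I}),
  \sum_(i <- F) absC (form h (f i)) ^+ 2 <= B * qd h.

Lemma bessel_form : bessel_family f ->
  (exists2 B : R, 0 < B & form_bessel B) /\
  forall h, ell2 (fun i => form h (f i)).
Proof.
move=> [b bP]; have hE h : (square_sum (fun i => form h (f i)) <= (b * qd h)%:E)%E.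
  have := bP (krein_symmetry D h); rewrite krein_normE absC_real.
  rewrite ger0_norm ?form_norm_ge0 // (form_norm_sqr hd qd0).
  rewrite (quad_symmetry (krein_hilbert_symmetry D)).
  by under eq_fun => i do rewrite hdot_symmetryE.
split; last by move=> h; rewrite /ell2 /=; apply: le_lt_trans (hE h) _; exact: ltry.
exists (`|b| + 1) => [|h F]; first by rewrite ltr_wpDl.
have := le_trans (square_sum_ge _ F) (hE h); rewrite lee_fin => /le_trans; apply.
rewrite ler_wpM2r ?(quad_ge0 hd qd0) //; apply: le_trans (ler_norm b) _.
by rewrite lerDl.
Qed.

Lemma form_suml (s : seq I) (P : pred I) (g : I -> H) h :
  form (\sum_(i <- s | P i) g i) h = \sum_(i <- s | P i) form (g i) h.
Proof.
apply: (big_morph (fun x => form x h)); last exact: herm_zerol.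
by move=> x y; rewrite (herm_addl hf).
Qed.

Lemma has_sum_form (A : set I) (g : I -> krein D) (v : H) h : has_sum A g v ->
  forall e : R, 0 < e -> exists F0 : {fset I}, forall F : {fset I},
    (F0 `<=` F)%fset ->
    absC (form v h - \sum_(i <- F | i \in A) form (g i) h) < e.
Proof.
move=> /has_sum_close gv e e0; have nh := form_norm_ge0 (hdot D) h.
have [|F0 F0P] := gv (e / (nrm h + 1)); first by rewrite divr_gt0 // ltr_wpDl.
exists F0 => F F0F; rewrite -form_suml -(herm_subl hf).
apply: le_lt_trans (form_bound D _ _) _.
have := F0P F F0F; rewrite ltr_pdivlMr ?ltr_wpDl //.
have := form_norm_ge0 (hdot D) (v - \sum_(i <- F | i \in A) g i).
set a := form_norm _ _ => a0 h1; apply: le_lt_trans h1.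
by rewrite ler_wpM2l // lerDl.
Qed.

Section Part.
Context (B : R) (B0 : 0 < B) (bf : form_bessel B).
Context (A : set I) (v : H -> H).
Context (vP : forall h, has_sum A (fun i => form h (f i) *: f i) (v h : krein D)).

Definition part_form h g := form (v h) g.

Lemma part_form_approx h g (e : R) : 0 < e -> exists F0 : {fset I},
  forall F : {fset I}, (F0 `<=` F)%fset ->
    absC (part_form h g - \sum_(i <- F | i \in A) form h (f i) * form (f i) g) < e.
Proof.
move=> e0; have [F0 F0P] := has_sum_form g (@vP h) e0; exists F0 => F F0F.
have := F0P F F0F.
by under eq_bigr => i _ do rewrite (herm_scalel hf).
Qed.

(** The vectors v h are given one at a time, so linearity in h is not immediate.
    Hermitian symmetry holds for the partial sums and passes to the limit; it
    turns linearity in the second argument into linearity in the first. *)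
Lemma part_form_hermitian : hermitian_form part_form.
Proof.
have conj_sym h g : part_form h g = Num.conj (part_form g h).
  apply/eqP; rewrite -subr_eq0; apply/eqP; apply: Normc.eq0_normc.
  apply/eqP; rewrite eq_le absC_ge0 andbT; apply/ler_addgt0Pr => e e0; rewrite add0r.
  have [|F1 F1P] := @part_form_approx h g (e / 2); first by lra.
  have [|F2 F2P] := @part_form_approx g h (e / 2); first by lra.
  pose F := (F1 `|` F2)%fset.
  have h1 := F1P F (fsubsetUl _ _); have := F2P F (fsubsetUr _ _).
  rewrite -absC_conj rmorphB rmorph_sum /=.
  under eq_bigr => i _ do rewrite rmorphM /= -!hf.2 mulrC.
  move: h1; set s := \sum_(i <- F | _) _ => h1 h2.
  have := le_normcD (part_form h g - s) (s - Num.conj (part_form g h)).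
  rewrite subrKA (absCB s) => h3; apply: le_trans h3 _; lra.
split=> // a x y z; rewrite [LHS]conj_sym [part_form x z]conj_sym [part_form y z]conj_sym.
by rewrite /part_form (herm_addr hf) (herm_scaler hf) rmorphD rmorphM /= conjCK.
Qed.

Lemma part_form_ge h (F : {fset I}) :
  \sum_(i <- F | i \in A) absC (form h (f i)) ^+ 2 <= quad part_form h.
Proof.
apply/ler_addgt0Pr => e e0.
have [F0 F0P] := @part_form_approx h h e e0.
have := F0P (F0 `|` F)%fset (fsubsetUl _ _).
have -> : \sum_(i <- (F0 `|` F)%fset | i \in A) form h (f i) * form (f i) h =
    (\sum_(i <- (F0 `|` F)%fset | i \in A) absC (form h (f i)) ^+ 2)%:C.
  rewrite rmorph_sum /=; apply: eq_bigr => i _; rewrite (hf.2 (f i)).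
  by rewrite rmorphXn /= -absCE sqr_normc.
rewrite (quadE part_form_hermitian) -rmorphB absC_real.
have := @ler_sum_fset R I F (F0 `|` F)%fset (fun i => i \in A)
  (fun i => absC (form h (f i)) ^+ 2) (fsubsetUr _ _) (fun i => sqr_ge0 _).
move=> h1 /ltW; rewrite ler_norml => /andP[h2 _]; move: h1 h2; lra.
Qed.

Lemma part_form_ge0 h : 0 <= quad part_form h.
Proof. by apply: le_trans (part_form_ge h fset0); rewrite big_mkcond big_seq_fset0. Qed.

Lemma part_form_bound h g : absC (part_form h g) <= B * (nrm h * nrm g).
Proof.
apply/ler_addgt0Pr => e e0; have [F0 F0P] := @part_form_approx h g e e0.
have := F0P F0 (fsubset_refl _); set s := \sum_(i <- F0 | _) _ => hs.
have sb : absC s <= B * (nrm h * nrm g).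
  rewrite -ler_sqr ?nnegrE ?absC_ge0 ?mulr_ge0 ?form_norm_ge0 ?(ltW B0) //.
  apply: le_trans (absC_sum_cauchy_schwarz _ _ _ _) _.
  have -> : (B * (nrm h * nrm g)) ^+ 2 = (B * qd h) * (B * qd g).
    by rewrite -!(form_norm_sqr hd qd0); ring.
  apply: ler_pM; try (by apply: sumr_ge0 => i _; exact: sqr_ge0).
    by apply: le_trans (bf h F0); apply: ler_sum_filter => i; exact: sqr_ge0.
  apply: le_trans (bf g F0).
  under eq_bigr => i _ do rewrite hf.2 absC_conj.
  by apply: ler_sum_filter => i; exact: sqr_ge0.
have := le_normcD (part_form h g - s) s; rewrite subrK.
move: hs sb; lra.
Qed.

(** Boundedness of the form, tested on g = J (v h). *)
Lemma part_norm h : nrm (v h) <= B * nrm h.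
Proof.
have := part_form_bound h (krein_symmetry D (v h)).
have -> : part_form h (krein_symmetry D (v h)) = (qd (v h))%:C.
  rewrite /part_form -(hdot_symmetryE D) -(quad_symmetry (krein_hilbert_symmetry D)).
  exact: (quadE hd).
rewrite absC_real ger0_norm ?(quad_ge0 hd qd0) //.
rewrite {2}/form_norm (quad_symmetry (krein_hilbert_symmetry D)) -/(form_norm _ _).
rewrite -(form_norm_sqr hd qd0) expr2 mulrA.
have [->|n0] := eqVneq (nrm (v h)) 0.
  by rewrite mulr_ge0 ?form_norm_ge0 // ltW.
by rewrite ler_pM2r // lt_neqAle eq_sym n0 form_norm_ge0.
Qed.

Lemma part_range h : ell2 (fun i => form h (f i)) ->
  synthesis_range f A (v h).
Proof. by move=> l2; exists (fun i => form h (f i)) => //; exact: vP. Qed.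

(** Cauchy-Schwarz for the coefficients of p and those of h. *)
Lemma part_pointwise p : synthesis_range f A p ->
  exists C : R, forall h, absC (form p h) ^+ 2 <= C * quad part_form h.
Proof.
move=> [c /ell2_bound[C C0 CP] pP]; exists C => h.
rewrite -[C * _]sqr_sqrtr ?mulr_ge0 ?part_form_ge0 ?(ltW C0) //.
rewrite ler_sqr ?nnegrE ?absC_ge0 ?sqrtr_ge0 //.
apply/ler_addgt0Pr => e e0; have [F0 F0P] := has_sum_form h pP e0.
have := F0P F0 (fsubset_refl _); set s := \sum_(i <- F0 | _) _ => hs.
have := le_normcD (form p h - s) s; rewrite subrK => h1.
suff sb : absC s <= Num.sqrt (C * quad part_form h) by move: hs h1 sb; lra.
rewrite -ler_sqr ?nnegrE ?absC_ge0 ?sqrtr_ge0 // sqr_sqrtr; last first.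
  by rewrite mulr_ge0 ?part_form_ge0 ?(ltW C0).
rewrite /s; under eq_bigr => i _ do rewrite (herm_scalel hf).
apply: le_trans (absC_sum_cauchy_schwarz _ _ _ _) _.
apply: ler_pM; try (by apply: sumr_ge0 => i _; exact: sqr_ge0).
  by apply: le_trans (CP F0); apply: ler_sum_filter => i; exact: sqr_ge0.
under eq_bigr => i _ do rewrite hf.2 absC_conj.
exact: part_form_ge.
Qed.

End Part.
End FrameForms.

(** * Accretivity of J-frame operators *)

Section Accretive.
Context (R : realType) (H : lmodType R[i]).

(** |h - t S h|^2 = |h|^2 - 2 t Re N (S h) h + t^2 |S h|^2, in which the linear term
    wins for small t. *)
Lemma accretive_contraction (N : H -> H -> R[i]) (S : H -> H) (a b : R) :
    hermitian_form N -> (forall x, x != 0 -> 0 < quad N x) -> 0 < a ->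
    (forall h, a * quad N h <= re (N (S h) h)) ->
    (forall h, quad N (S h) <= b * quad N h) ->
  exists t q : R, [/\ 0 < t, 0 <= q, q < 1 &
    forall h, form_norm N (h - t%:C *: S h) <= q * form_norm N h].
Proof.
move=> hN posN a0 acc bnd.
(* b' >= b, and enlarged so that a^2 / b' < 1; t = a / b' minimises
   1 - 2 t a + t^2 b' *)
pose b' := `|b| + a ^+ 2 + 1.
have bb' : b <= b' by have := ler_norm b; have := sqr_ge0 a; rewrite /b'; lra.
have b'0 : 0 < b' by rewrite /b'; have := sqr_ge0 a; have := normr_ge0 b; lra.
have ab : a ^+ 2 / b' < 1.
  by rewrite ltr_pdivrMr // mul1r /b'; have := normr_ge0 b; lra.
have ab0 : 0 < a ^+ 2 / b' by rewrite divr_gt0 ?exprn_gt0.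
exists (a / b'), (Num.sqrt (1 - a ^+ 2 / b')); split.
- by rewrite divr_gt0.
- exact: sqrtr_ge0.
- by rewrite -[ltRHS]sqrtr1 ltr_sqrt //; lra.
move=> h; rewrite /form_norm -sqrtrM; last by lra.
apply: ler_wsqrtr.
rewrite (quadB hN) (quadZ hN) absC_real real_normK ?num_real //.
rewrite (hN.2 h) (herm_scalel hN) re_conj.
have -> : re ((a / b')%:C * N (S h) h) = a / b' * re (N (S h) h).
  by case: (N (S h) h) => x y /=; rewrite mul0r subr0.
have q0 := quad_ge0 hN posN h.
have h1 : (a / b') ^+ 2 * quad N (S h) <= (a / b') ^+ 2 * (b' * quad N h).
  rewrite ler_wpM2l ?sqr_ge0 //; apply: le_trans (bnd h) _.
  by rewrite ler_wpM2r.
have h2 : a / b' * (a * quad N h) <= a / b' * re (N (S h) h).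
  by rewrite ler_wpM2l // divr_ge0 ?ltW.
have e1 : (a / b') ^+ 2 * (b' * quad N h) = a ^+ 2 / b' * quad N h.
  by field; rewrite gt_eqF.
have e2 : a / b' * (a * quad N h) = a ^+ 2 / b' * quad N h by ring.
move: h1 h2; rewrite e1 e2; lra.
Qed.

Context (form : {hermitian H for false & Num.conj}).
Context (D : fundamental_decomposition form).
Local Notation nrm := (form_norm (hdot D)).
Local Notation qd := (quad (hdot D)).

Lemma form_nondegenerate x : (forall y, form x y = 0) -> x = 0.
Proof.
move=> x0; apply/eqP; apply: contraT => /(quad_hdot_gt0 D).
rewrite -(quad_symmetry (krein_hilbert_symmetry D)) /quad hdot_symmetryE x0.
by rewrite ltxx.
Qed.

(** N h g = [v h + w h, g] is the sum of [h, f i] [f i, g] over all i. In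
    [v h + w h, v h - w h] the mixed terms contribute only an imaginary part, so
    the real part of N (S h) h is [v h, v h] - [w h, w h]. *)
Lemma J_frame_operator_accretive (S : krein D -> krein D) : J_frame_operator S ->
  exists N : H -> H -> R[i], exists c K : R, [/\ hermitian_form N, 0 < c & 0 < K] /\
    [/\ forall h, c * qd h <= quad N h <= K * qd h,
        forall h, c * qd h <= re (N (S h) h),
        forall h, qd (S h) <= K * qd h,
        linear S & forall x y, form (S x) y = form x (S y)].
Proof.
move=> [I [f [[bes maxP maxN] SP]]].
have hf := form_hermitian form; have hd := hdot_hermitian_form D.
have qd0 := @quad_hdot_gt0 _ _ _ D; have kH := krein_hilbert_symmetry D.
have [[B B0 bf] l2] := bessel_form bes.
have /choice [v /choice [w vwP]] := SP.
have vP h : has_sum (index_pos f) (fun i => form h (f i) *: f i) (v h) by have [] := vwP h.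
have wP h : has_sum (index_neg f) (fun i => form h (f i) *: f i) (w h) by have [] := vwP h.
have SE h : S h = v h - w h by have [] := vwP h.
have {maxP} maxP := maximal_positiveE maxP; have {maxN} maxN := maximal_negativeE maxN.
pose Np := part_form form v; pose Nm := part_form form w.
have hNp : hermitian_form Np := part_form_hermitian vP.
have hNm : hermitian_form Nm := part_form_hermitian wP.
have Np0 : forall h, 0 <= quad Np h := part_form_ge0 vP.
have Nm0 : forall h, 0 <= quad Nm h := part_form_ge0 wP.
have [c1 [K1 [c10 K10 coP]]] : exists c K : R, [/\ 0 < c, 0 < K &
    forall h, c * qd h + quad form h <= K * quad Np h].
  have formE : (fun x y => hdot D (krein_symmetry D x) y) = form.
    by apply/funext => x; apply/funext => y; exact: hdot_symmetryE.
  have := maximal_definite_coercive kH (M := synthesis_range f (index_pos f)) (Q := quad Np).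
  rewrite formE; apply => //; first by move=> a h; exact: quadZ.
  move=> p pM; have [C CP] := part_pointwise vP pM; exists C => h.
  by rewrite hdot_symmetryE.
have [c2 [K2 [c20 K20 coN]]] : exists c K : R, [/\ 0 < c, 0 < K &
    forall h, c * qd h - quad form h <= K * quad Nm h].
  have formE : (fun x y => hdot D (- krein_symmetry D x) y) = (fun x y => - form x y).
    apply/funext => x; apply/funext => y.
    by rewrite (herm_oppl hd) hdot_symmetryE.
  have qN h : quad (fun x y => - form x y) h = - quad form h by rewrite /quad raddfN.
  have := maximal_definite_coercive (hilbert_symmetryN kH)
    (M := synthesis_range f (index_neg f)) (Q := quad Nm).
  rewrite formE => /(_ maxN Nm0) [].
  - by move=> a h; exact: quadZ.
  - move=> p pM; have [C CP] := part_pointwise wP pM.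
    by exists C => h; rewrite (herm_oppl hd) normcN hdot_symmetryE.
  move=> c [K [c0 K0 cK]]; exists c, K; split=> // h.
  by rewrite -qN.
pose N x y := Np x y + Nm x y.
have hN : hermitian_form N.
  split=> [a x y z|x y]; first by rewrite /N hNp.1 hNm.1; ring.
  by rewrite /N rmorphD /= hNp.2 hNm.2.
have qN h : quad N h = quad Np h + quad Nm h by rewrite /quad /N raddfD.
have NE x y : N x y = form (v x + w x) y by rewrite (herm_addl hf).
have Ssym x y : form (S x) y = form x (S y).
  rewrite (hf.2 x) !SE !(herm_subl hf) rmorphB /=.
  by congr (_ - _); [exact: hNp.2|exact: hNm.2].
have linS : linear S.
  move=> a x y; apply/eqP; rewrite -subr_eq0; apply/eqP.
  apply: form_nondegenerate => z.
  by rewrite (herm_subl hf) (hf.1 a) !Ssym hf.1 subrr.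
have nv h := part_norm B0 bf vP h; have nw h := part_norm B0 bf wP h.
have [[_ [a1 a10 aP]] _] := maxP; have [[_ [a2 a20 aN]] _] := maxN.
have qv h : a1 * qd (v h) <= quad form (v h) by apply: aP; exact: part_range.
have qw h : a2 * qd (w h) <= - quad form (w h).
  have := aN (w h) (part_range wP (l2 h)).
  by rewrite [leRHS]/quad raddfN.
have qvw h : qd (v h) <= B ^+ 2 * qd h /\ qd (w h) <= B ^+ 2 * qd h.
  rewrite -!(form_norm_sqr hd qd0) -!exprMn.
  by rewrite !ler_sqr ?nnegrE ?mulr_ge0 ?form_norm_ge0 ?(ltW B0).
have nn := form_norm_complete hd qd0 (hs_complete kH).
pose K := K1 + K2; pose c := c1 + c2.
have c0 : 0 < c by rewrite addr_gt0.
have K0 : 0 < K by rewrite addr_gt0.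
(* the terms quad form h of the two estimates cancel *)
have coer h : c * qd h <= K * quad N h.
  have := coP h; have := coN h; rewrite qN /c /K => h1 h2.
  have := mulr_ge0 (ltW K10) (Nm0 h); have := mulr_ge0 (ltW K20) (Np0 h).
  move: h1 h2; rewrite /Np /Nm; lra.
have upper h : quad N h <= 2 * B * qd h.
  rewrite qN -(form_norm_sqr hd qd0) expr2.
  have := part_form_bound B0 bf vP h h; have := part_form_bound B0 bf wP h h.
  have := Re_le_absC (Np h h); have := Re_le_absC (Nm h h).
  have := ler_norm (re (Np h h)); have := ler_norm (re (Nm h h)).
  rewrite /quad; lra.
pose a := Num.min a1 a2; have a0 : 0 < a by rewrite lt_min a10.
have lower h : a * (qd (v h) + qd (w h)) <= re (N (S h) h).
  have -> : re (N (S h) h) = quad form (v h) - quad form (w h).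
    rewrite hN.2 re_conj NE SE (herm_subr hf) !(herm_addl hf) (hf.2 (w h) (v h)).
    rewrite /quad; case: (form (v h) (v h)) (form (v h) (w h)) (form (w h) (w h)).
    by move=> x x' [y y'] [z z'] /=; ring.
  have : a * qd (v h) <= a1 * qd (v h).
    by rewrite ler_wpM2r ?(quad_ge0 hd qd0) // ge_min lexx.
  have : a * qd (w h) <= a2 * qd (w h).
    by rewrite ler_wpM2r ?(quad_ge0 hd qd0) // ge_min lexx orbT.
  have := qv h; have := qw h; lra.
have below h : (c / K) ^+ 2 * qd h <= 2 * (qd (v h) + qd (w h)).
  have sum_le : (c / K) * nrm h <= nrm (v h + w h).
    have [->|n0] := eqVneq (nrm h) 0; first by rewrite mulr0 form_norm_ge0.
    have n1 : 0 < nrm h by rewrite lt_neqAle eq_sym n0 form_norm_ge0.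
    rewrite -(ler_pM2r n1) -(mulrA (c / K)) -expr2 (form_norm_sqr hd qd0).
    have := coer h; rewrite -ler_pdivrMl // mulrA [K^-1 * c]mulrC => h1.
    apply: le_trans h1 _; rewrite /quad NE.
    apply: le_trans (ler_norm _) _; apply: le_trans (Re_le_absC _) _.
    exact: form_bound.
  apply: (@le_trans _ _ (qd (v h + w h))); last first.
    by have := quad_addle kH (v h) (w h); lra.
  rewrite -!(form_norm_sqr hd qd0) -exprMn ler_sqr ?nnegrE ?form_norm_ge0 //.
  by rewrite mulr_ge0 ?form_norm_ge0 // divr_ge0 ?ltW.
have cK0 : 0 < c / K by rewrite divr_gt0.
exists N, (Num.min (c / K) (a / 2 * (c / K) ^+ 2)), (2 * B + 4 * B ^+ 2); split.
  split=> //; first by rewrite lt_min cK0 mulr_gt0 ?exprn_gt0 ?divr_gt0.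
  by rewrite addr_gt0 ?mulr_gt0 ?exprn_gt0.
have q0 h := quad_ge0 hd qd0 h.
split=> // h.
- apply/andP; split.
    apply: (@le_trans _ _ (c / K * qd h)).
      by rewrite ler_wpM2r // ge_min lexx.
    by rewrite mulrAC ler_pdivrMr // [leRHS]mulrC.
  apply: le_trans (upper h) _; rewrite ler_wpM2r // lerDl.
  by rewrite mulr_ge0 ?sqr_ge0.
- apply: (@le_trans _ _ (a / 2 * (c / K) ^+ 2 * qd h)).
    by rewrite ler_wpM2r // ge_min lexx orbT.
  apply: le_trans (lower h).
  have := ler_wpM2l (ltW a0) (below h); lra.
rewrite SE; have [h1 h2] := qvw h.
have := quad_addle kH (v h) (- w h); rewrite (quadN hd) => h3.
have := mulr_ge0 (ltW B0) (q0 h); move: h1 h2 h3.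
rewrite /=; lra.
Qed.

End Accretive.

(** * Spectra in the sector *)

Section Sector.
Context (R : realType).

Lemma sector_pi4_re (z : R[i]) : sector_pi4 R z -> 0 < re z.
Proof.
move=> [r [t [r0 t1 t2 ->]]] /=; apply: mulr_gt0 => //; apply: cos_gt0_pihalf.
have := pi_gt0 R; lra.
Qed.

(** Re z^2 > 0 says that |Im z| < |Re z|, that is, that the slope of z has absolute
    value less than 1 = tan (pi / 4). *)
Lemma sector_pi4P (z : R[i]) : 0 < re z -> 0 < re (z ^+ 2) -> sector_pi4 R z.
Proof.
case: z => x y; rewrite expr2 /= => x0; rewrite subr_gt0 => yx.
pose t := atan (y / x); exists (x / cos t), t.
have xy : `|y| < x.
  rewrite -ltr_sqr ?nnegrE ?(ltW x0) // real_normK ?num_real // !expr2 //.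
move: xy; rewrite ltr_norml => /andP[h1 h2].
have c0 : 0 < cos t by apply: cos_gt0_pihalf; rewrite atan_gtNpi2 atan_ltpi2.
split.
- by rewrite divr_gt0.
- by rewrite -atan1 -atanN; apply: lt_atan; rewrite ltr_pdivlMr // mulN1r.
- by rewrite -atan1; apply: lt_atan; rewrite ltr_pdivrMr // mul1r.
have st : sin t = y / x * cos t by rewrite -[y / x]atanK -/t /tan divfK ?gt_eqF.
by rewrite st; congr (_ +i* _); field; rewrite ?gt_eqF.
Qed.

End Sector.

Section KreinOperators.
Context (R : realType) (H : lmodType R[i]).
Context (form : {hermitian H for false & Num.conj}).
Context (D : fundamental_decomposition form).
Implicit Types T : krein D -> krein D.
Local Notation nrm := (form_norm (hdot D)).
Context (n : H -> R) (nP : complete_norm n) (a b : R) (a0 : 0 < a) (b0 : 0 < b).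
Context (le_n : forall x, n x <= a * nrm x) (le_nrm : forall x, nrm x <= b * n x).

Lemma bounded_operatorP T : bounded_operator T <-> linear T /\ cbounded n T.
Proof.
split=> -[linT [M MP]]; split=> //.
  have TM x : nrm (T x) <= absC M * nrm x.
    rewrite -lecR -krein_normE rmorphM /= -absCE -krein_normE.
    have := MP x; rewrite -[X in _ <= X -> _]ger0_norm ?normrM ?normr_id //.
    exact: le_trans (normr_ge0 _) (MP x).
  exists (a * (absC M * b)) => x; apply: le_trans (le_n _) _.
  rewrite -mulrA ler_pM2l //; apply: le_trans (TM x) _.
  by rewrite -mulrA ler_wpM2l ?absC_ge0.
exists (b * (`|M| * a))%:C => x; rewrite !krein_normE -rmorphM lecR.
apply: le_trans (le_nrm _) _; rewrite -mulrA ler_pM2l //.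
apply: le_trans (MP x) _; apply: (@le_trans _ _ (`|M| * n x)).
  by rewrite ler_wpM2r ?(cnorm_ge0 nP) ?ler_norm.
by rewrite -mulrA ler_wpM2l.
Qed.

Lemma spectrumP T z : linear T ->
  spectrum T z <-> ~ cinvertible n (fun x => T x - z *: x).
Proof.
move=> linT; have linTz : linear (fun x => T x - z *: x).
  move=> c x y; rewrite linT scalerBr scalerDr !scalerA opprD addrACA.
  by rewrite [z * c]mulrC.
have iff_not A B : (A <-> B) -> (~ A <-> ~ B) by move=> [ab ba]; split=> h ?; apply: h; auto.
apply: iff_not; split=> [[B [/bounded_operatorP[linB [M MP]] BT TB]]|[sT [M MP]]].
  split=> [x|]; first by exists (B x); exact: TB.
  by exists M => y; rewrite -[in leLHS](BT y); exact: MP.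
have /choice [B BP] := sT.
have inj x y : T x - z *: x = T y - z *: y -> x = y.
  move=> xy; apply/eqP; rewrite -subr_eq0; apply/eqP; apply: (cnorm_eps nP) => e e0.
  apply: le_trans (MP _) _.
  by rewrite (lin_sub linTz) xy subrr (cnorm0 nP) mulr0 ltW.
exists B; split=> [|x|]; [apply/bounded_operatorP; split| |exact: BP].
- by move=> c x y; apply: inj; rewrite BP linTz !BP.
- by exists M => x; rewrite -[in leRHS](BP x); exact: MP.
- by apply: inj; rewrite BP.
Qed.

End KreinOperators.

Theorem theorem6p1 (R : realType) (H : lmodType R[i])
    (form : {hermitian H for false & Num.conj})
    (D : fundamental_decomposition form) (S : krein D -> krein D) :
  J_frame_operator S ->
  exists P : krein D -> krein D,
    unique (fun Q : krein D -> krein D =>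
      [/\ bounded_operator Q, Q \o Q = S & spectrum Q `<=` sector_pi4 R]) P
    /\ krein_selfadjoint P.
Proof.
move=> /J_frame_operator_accretive[N [c [K [[hN c0 K0] [NP acc Sq linS Ssym]]]]].
have hf := form_hermitian form; have hd := hdot_hermitian_form D.
have qd0 := @quad_hdot_gt0 _ _ _ D.
have posN x : x != 0 -> 0 < quad N x.
  move=> /qd0 x0; have /andP[h _] := NP x; apply: lt_le_trans h.
  exact: mulr_gt0.
have cN : complete_on [set: H] (quad N).
  move=> u _ uC; have [//|e e0|l _ lP] := @hdot_complete _ _ _ D u.
    have [|M MP] := uC (c * e); first exact: mulr_gt0.
    exists M => i j Mi Mj; rewrite -(ltr_pM2l c0); apply: le_lt_trans (MP i j Mi Mj).
    by have /andP[] := NP (u i - u j).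
  exists l => // e e0; have [|M MP] := lP (e / K); first exact: divr_gt0.
  exists M => i Mi; have /andP[_ h] := NP (u i - l); apply: le_lt_trans h _.
  by have := MP i Mi; rewrite ltr_pdivlMr // mulrC.
have nP := form_norm_complete hN posN cN.
set n := form_norm N in nP.
have sqrt_le (A : R) q1 q2 : 0 < A -> q1 <= A * q2 ->
    Num.sqrt q1 <= Num.sqrt A * Num.sqrt q2.
  by move=> A0 h; rewrite -sqrtrM ?(ltW A0) // ler_wsqrtr.
have le_n x : n x <= Num.sqrt K * form_norm (hdot D) x.
  by apply: sqrt_le => //; have /andP[] := NP x.
have le_nrm x : form_norm (hdot D) x <= Num.sqrt c^-1 * n x.
  apply: sqrt_le; rewrite ?invr_gt0 //; have /andP[h _] := NP x.
  by rewrite mulrC ler_pdivlMr // mulrC.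
have sK0 : 0 < Num.sqrt K by rewrite sqrtr_gt0.
have sc0 : 0 < Num.sqrt c^-1 by rewrite sqrtr_gt0 invr_gt0.
have bdP := bounded_operatorP nP sK0 sc0 le_n le_nrm.
have spP := spectrumP nP sK0 sc0 le_n le_nrm.
have [|||t [q [t0 q0 q1 Eq]]] := @accretive_contraction _ H N S (c / K) (K * (K / c)) hN posN.
- exact: divr_gt0.
- move=> h; apply: le_trans (acc h); rewrite mulrAC ler_pdivrMr //.
  by rewrite -mulrA ler_pM2l // mulrC; have /andP[] := NP h.
- move=> h; have /andP[_ h1] := NP (S h); apply: le_trans h1 _.
  rewrite -mulrA ler_pM2l //; apply: le_trans (Sq h) _.
  rewrite -mulrA ler_pM2l // mulrC ler_pdivlMr // mulrC.
  by have /andP[] := NP h.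
pose E (h : H) : H := h - t%:C *: S h.
have linE : linear E.
  move=> d x y; rewrite /E linS scalerBr scalerDr !scalerA opprD addrACA.
  by rewrite mulrC.
have [Y [linY Yq YE Ylim]] := sqrt_contraction nP linE q0 q1 Eq.
pose s := Num.sqrt t; have s0 : 0 < s by rewrite sqrtr_gt0.
have ss : s * s = t by rewrite -expr2 sqr_sqrtr // ltW.
have tC0 : t%:C != 0 by rewrite fmorph_eq0 gt_eqF.
have sC0 : s%:C != 0 by rewrite fmorph_eq0 gt_eqF.
pose P (h : krein D) : krein D := (s%:C)^-1 *: (h - Y h).
have linP : linear P.
  move=> d x y; rewrite /P linY opprD addrACA -scalerBr scalerDr !scalerA.
  by rewrite [d * _]mulrC.
have PS x : P (P x) = S x.
  rewrite {1}/P (lin_scale linY) -scalerBr YE scalerA -invfM -rmorphM ss.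
  by rewrite /E opprB addrC subrK scalerA mulVf // scale1r.
have reg (r : R) (z : R[i]) : 0 < r -> re z <= 0 -> 1 <= absC (1 - r%:C * z).
  move=> r0 z0; apply: le_trans (Re_le_absC _); apply: le_trans (ler_norm _).
  case: z z0 => x y /= x0; rewrite mul0r subr0 lerDl oppr_ge0.
  by rewrite pmulr_rle0.
have invP z : re z <= 0 -> cinvertible n (fun x => P x - z *: x).
  move=> z0.
  have := cinvertible_scale nP (invr_neq0 sC0) (neumann nP linY q0 q1 Yq (reg s z s0 z0)).
  congr (cinvertible n _); apply/funext => x; rewrite /P scalerBl scale1r.
  by rewrite addrAC scalerBr [in LHS]scalerA mulrA mulVf // mul1r.
have invS z : re z <= 0 -> cinvertible n (fun x => S x - z *: x).
  move=> z0.
  have := cinvertible_scale nP (invr_neq0 tC0) (neumann nP linE q0 q1 Eq (reg t z t0 z0)).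
  congr (cinvertible n _); apply/funext => x; rewrite /E scalerBl scale1r.
  rewrite opprB addrC subrKA -scalerA -scalerBr scalerA mulVf //.
  by rewrite scale1r.
have bP : cbounded n P.
  exists (s^-1 * (1 + q)) => x; rewrite /P (cnormZ nP) -fmorphV absC_real.
  rewrite ger0_norm ?invr_ge0 ?(ltW s0) // -mulrA ler_pM2l ?invr_gt0 //.
  apply: le_trans (cnormD nP _ _) _; rewrite (cnormN nP) mulrDl mul1r lerD2l.
  exact: Yq.
have symY : forall x y, form (Y x) y = form x (Y y).
  apply: (sqrt_limit_symmetric nP (K := Num.sqrt c^-1 * Num.sqrt c^-1) hf.1 _ _ _ q0 q1 Ylim).
  - by move=> d x y z; rewrite (herm_addr hf) (herm_scaler hf).
  - move=> x y; apply: le_trans (form_bound D x y) _; rewrite mulrACA.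
    by apply: ler_pM; rewrite ?form_norm_ge0 ?le_nrm.
  - move=> x y; rewrite /E (herm_subl hf) (herm_subr hf) (herm_scalel hf).
    rewrite (herm_scaler hf) Ssym; congr (_ - _ * _).
    by rewrite /Num.conj /= oppr0.
exists P; split; last first.
  move=> x y; rewrite /P (herm_scalel hf) (herm_scaler hf) (herm_subl hf).
  rewrite (herm_subr hf) symY; congr (_ * _).
  by rewrite -fmorphV /Num.conj /= oppr0.
split.
  split; [exact/bdP|by apply/funext => x; exact: PS|].
  move=> z /(spP _ _ linP) nz; apply: sector_pi4P; rewrite ltNge; apply/negP => z0.
    by apply: nz; exact: invP.
  apply: nz; apply: (@cinvertible_factor _ _ n nP _ (fun x => P x + z *: x)).
  - move=> x; rewrite (lin_add linP) (lin_sub linP) (lin_scale linP z).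
    rewrite scalerDr scalerBr.
    by rewrite subrKA opprD addrA addrK.
  - have [M M0 MP] := cbounded_ge0 nP bP; exists (M + absC z) => x.
    apply: le_trans (cnormD nP _ _) _; rewrite (cnormZ nP z) mulrDl lerD2r.
    exact: MP.
  have := invS _ z0; congr (cinvertible n _); apply/funext => x.
  rewrite (lin_add linP) PS (lin_scale linP z) scalerDr scalerA -expr2.
  by rewrite opprD addrA addrK.
move=> Q [/bdP[linQ bQ] QQ spQ]; apply/funext => x.
have QS y : Q (Q y) = S y by rewrite -QQ.
pose Q' (y : H) : H := s%:C *: Q y.
have linQ' : linear Q' by move=> d u v; rewrite /Q' linQ scalerDr !scalerA mulrC.
have bQ' : cbounded n Q'.
  have [M MP] := bQ; exists (s * M) => y.
  by rewrite /Q' (cnormZr nP _ (ltW s0)) -mulrA ler_pM2l.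
have QY y : Q (Y y) = Y (Q y).
  apply: (sqrt_limit_commute nP linQ bQ _ q0 q1 Ylim) => u.
  by rewrite /E (lin_sub linQ) (lin_scale linQ) -!QS.
have := sqrt_unique nP linY q0 (ltW q1) Yq linQ' bQ' _ _ _ x.
rewrite /P => <-; rewrite /Q'.
- by rewrite scalerA mulVf // scale1r.
- by move=> y; rewrite QY (lin_scale linY).
- move=> w w0.
  have inv : cinvertible n (fun y => Q y - (- (w / s%:C)) *: y).
    apply: contrapT => /(spP _ _ linQ)/spQ/sector_pi4_re.
    apply/negP; rewrite -leNgt raddfN oppr_le0 -fmorphV mulrC.
    by case: (w) w0 => u u' /= u0; rewrite mul0r subr0 mulr_ge0 // invr_ge0 ltW.
  have := cinvertible_scale nP sC0 inv; congr (cinvertible n _).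
  apply/funext => y; rewrite scaleNr opprK scalerDr scalerA mulrCA mulfV //.
  by rewrite mulr1.
move=> y; rewrite (lin_scale linQ) QS scalerA -rmorphM ss YE /E.
by rewrite opprB addrC subrK.
Qed.
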